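(* Let $R_{\mathrm{Bc}}=\mathbb Z\left[\frac12,a_1,a_2,a_3\right]$ and let $F_{\mathrm{Bc}}(u,v)$ be the Buchstaber formal group law over $R_{\mathrm{Bc}}$. Then $F_{\mathrm{Bc}}$ is universal among one-dimensional commutative formal group laws with formal inverse $\bar u=-u$ whose modulus square construction belongs to the Buchstaber family. Namely: the law $F_{\mathrm{Bc}}$ is itself of this kind, and if $S$ is a commutative $\mathbb Z[1/2]$-algebra and $F(u,v)\in S[[u,v]]$ is a one-dimensional commutative formal group law over $S$ with formal inverse $\bar u=-u$ whose modulus square is $\mathbb G_{\boldsymbol\alpha}$ for some $\boldsymbol\alpha=(\alpha_1,\alpha_2,\alpha_3)\in S^3$, then there exists a unique $\mathbb Z[1/2]$-algebra homomorphism $\varphi:R_{\mathrm{Bc}}\to S$ such that $$F(u,v)=\varphi_*F_{\mathrm{Bc}}(u,v),$$ where $\varphi_*F_{\mathrm{Bc}}\in S[[u,v]]$ is obtained from $F_{\mathrm{Bc}}$ by applying $\varphi$ coefficientwise.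
   Context: Let $Q(t)=1-a_1t^2+a_2t^4-a_3t^6$, $\sqrt{Q(t)}$ the series with constant term $1$, $H(u,v)=\frac{u\sqrt{Q(v)}-v\sqrt{Q(u)}}{u-v}\in R_{\mathrm{Bc}}[[u,v]]$. The Buchstaber formal group law is $$F_{\mathrm{Bc}}(u,v)=\left[\left(\frac{u\sqrt{Q(v)}-v\sqrt{Q(u)}}{u^2-v^2}\right)^2+a_3u^2v^2\right]^{-1/2}=\frac{u+v}{\sqrt{H(u,v)^2+a_3u^2v^2(u+v)^2}}.$$ Modulus square construction: for a formal group law $F$ over $S$ with formal inverse $\bar u$, put $x=u\bar u$, $y=v\bar v$, $z_1=F(u,v)F(\bar u,\bar v)$, $z_2=F(u,\bar v)F(\bar u,v)$ (so for $\bar u=-u$: $x=-u^2$, $y=-v^2$, $z_1=-F(u,v)^2$, $z_2=-F(u,-v)^2$). Then $z_1+z_2$ and $z_1z_2$ are power series in $x,y$ over $S$, and the modulus square of $F$ is the two-valued formal group $x*y=[z_1,z_2]$, $z_1,z_2$ being the roots of $z^2-(z_1+z_2)z+z_1z_2$. Buchstaber family: for $\boldsymbol\alpha\in S^3$, $$\mathcal B_{\boldsymbol\alpha}(z;x,y)=(x+y+z-\alpha_2xyz)^2-4(1+\alpha_3xyz)(xy+yz+xz+\alpha_1xyz),$$ which is quadratic in $z$ with leading coefficient $C\in S[[x,y]]$ having constant term $1$. $\mathbb G_{\boldsymbol\alpha}$ is the two-valued formal group whose values are the roots of $\mathcal B_{\boldsymbol\alpha}(z;x,y)=0$; ''the modulus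 square of $F$ is $\mathbb G_{\boldsymbol\alpha}$'' means $(z-z_1)(z-z_2)=C^{-1}\mathcal B_{\boldsymbol\alpha}(z;x,y)$. *)

(* Defs.v *)
From HB Require Import structures.
From mathcomp Require Import all_boot all_order all_algebra.
From mathcomp Require Import ssrcomplements mpoly ring.
From mathcomp Require Import boolp classical_sets.
Set Implicit Arguments.
Unset Strict Implicit.
Unset Printing Implicit Defensive.
Import GRing.Theory Num.Theory.
Local Open Scope ring_scope.

(* ------------------------------------------------------------------------ *)
(* The ring Z[1/2], as the subring of rat of the fractions n / 2 ^ k.        *)
Definition dyadic : {pred rat} :=
  fun q => `[< exists k, 2%:R ^+ k * q \is a Num.int >].

Lemma dyadic_subring : subring_closed dyadic.
Proof.
split=> [|x y /asboolP[i xi] /asboolP[j yj]|x y /asboolP[i xi] /asboolP[j yj]].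
- by apply/asboolP; exists 0%N; rewrite mul1r.
- apply/asboolP; exists (i + j)%N; rewrite mulrBr exprD rpredB //.
    by rewrite mulrAC rpredM // rpredX.
  by rewrite -mulrA rpredM // rpredX.
- apply/asboolP; exists (i + j)%N; rewrite exprD mulrACA rpredM //.
Qed.

HB.instance Definition _ := GRing.isSubringClosed.Build rat dyadic dyadic_subring.

Record Zhalf := MkZhalf { zhalf_val :> rat; _ : zhalf_val \in dyadic }.
HB.instance Definition _ := [isSub for zhalf_val].
HB.instance Definition _ := [Choice of Zhalf by <:].
HB.instance Definition _ := [SubChoice_isSubComNzRing of Zhalf by <:].

Lemma Zhalf_2inv : exists h : Zhalf, h + h = 1.
Proof.
have h : (2%:R^-1 : rat) \in dyadic by apply/asboolP; exists 1%N; rewrite mulfV.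
by exists (MkZhalf h); apply: val_inj; rewrite /= -[2%:R^-1]mul1r -splitr.
Qed.

(* ------------------------------------------------------------------------ *)
(* Formal power series in n variables: the coefficient family of the         *)
(* monomials.  R may be the zero ring.                                       *)
Record series (n : nat) (R : Type) := Series { scoef :> 'X_{1..n} -> R }.

Notation "{ 'series' R [ n ] }" := (series n R)
  (at level 0, R, n at level 2, format "{ 'series'  R [ n ] }") : type_scope.

Lemma seriesP n (R : Type) (f g : {series R[n]}) : f =1 g <-> f = g.
Proof. by case: f g => f [g]; split=> [/= /funext ->|->]. Qed.

HB.instance Definition _ n (R : Type) := gen_eqMixin {series R[n]}.
HB.instance Definition _ n (R : Type) := gen_choiceMixin {series R[n]}.

Section SeriesRing.
Variables (n : nat) (R : comPzRingType).
Implicit Types f g h : {series R[n]}.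

Definition series_const (c : R) : {series R[n]} :=
  Series (fun m => if m == 0%MM then c else 0).
Definition series_opp f : {series R[n]} := Series (fun m => - f m).
Definition series_add f g : {series R[n]} := Series (fun m => f m + g m).
Definition series_mul f g : {series R[n]} := Series (fun m =>
  \sum_(k : 'X_{1..n < (mdeg m).+1} | (k <= m)%MM) f k * g (m - k)%MM).

Lemma series_addA : associative series_add.
Proof. by move=> f g h; apply/seriesP => m /=; rewrite addrA. Qed.
Lemma series_addC : commutative series_add.
Proof. by move=> f g; apply/seriesP => m /=; rewrite addrC. Qed.
Lemma series_add0 : left_id (series_const 0) series_add.
Proof. by move=> f; apply/seriesP => m /=; rewrite if_same add0r. Qed.
Lemma series_addN : left_inverse (series_const 0) series_opp series_add.
Proof. by move=> f; apply/seriesP => m /=; rewrite if_same addNr. Qed.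

HB.instance Definition _ := GRing.isZmodule.Build {series R[n]}
  series_addA series_addC series_add0 series_addN.

Lemma series_mulE f g m b : (mdeg m < b)%N ->
  series_mul f g m = \sum_(k : 'X_{1..n < b} | (k <= m)%MM) f k * g (m - k)%MM.
Proof.
move=> mb; pose I : subFinType _ := 'X_{1..n < (mdeg m).+1}.
pose J : subFinType _ := 'X_{1..n < b}.
rewrite /= (big_sub_widen I J (fun k => (k <= m)%MM)
  (fun k => f k * g (m - k)%MM)) /=; last by move=> x /leq_trans; apply.
apply: eq_bigl => k; case: (boolP (k <= m)%MM) => //= km.
by rewrite ltnS -(submK km) mdegD leq_addl.
Qed.

Lemma series_mulC : commutative series_mul.
Proof.
move=> f g; apply/seriesP => m; rewrite (@series_mulE g f _ _ (ltnSn _)) /=.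
have pr (h : 'X_{1..n}) : (mdeg (m - h)%MM < (mdeg m).+1)%N.
  by rewrite ltnS mdegB.
pose F (k : 'X_{1..n < (mdeg m).+1}) := BMultinom (pr k).
have inv_F (h : 'X_{1..n}): (h <= m)%MM -> (m - (m - h))%MM = h.
  by move=> le_hm; rewrite submBA // addmC addmK.
rewrite (reindex_onto F F) //=; last first.
  by move=> h /inv_F eqh; apply/eqP; rewrite eqE /= eqh.
apply: eq_big => [h /=|h /andP[_ /eqP]]; last first.
  by rewrite mulrC => /(congr1 val) /= ->.
rewrite lem_subr eqE /=.
by apply/eqP/idP => [<-|/inv_F //]; apply/mnm_lepP=> i; rewrite !mnmBE leq_subr.
Qed.

Lemma series_mulA : associative series_mul.
Proof.
move=> p q r; apply/seriesP => mi; set b := (mdeg mi).+1.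
rewrite (series_mulC q r) (series_mulC (series_mul p q) r).
rewrite !(@series_mulE _ _ mi b) //.
have h m : (mdeg (mi - m)%MM < b)%N by rewrite ltnS mdegB.
pose coef3 (mj mk : 'X_{1..n}) := p mj * (r mk * q (mi - mj - mk)%MM).
transitivity (\sum_(mj : 'X_{1..n < b} | (mj <= mi)%MM)
                \sum_(mk : 'X_{1..n < b} | (mk <= mi - mj)%MM)
                   coef3 mj mk).
  by apply: eq_bigr => mj _; rewrite (@series_mulE _ _ _ b) // mulr_sumr.
pose P (mj : 'X_{1..n < b}) := (mj <= mi)%MM.
rewrite (exchange_big_dep P) //= {}/P; last first.
  by move=> mj mk _ /lepm_trans; apply; apply/lem_subr.
apply: eq_bigr => mk /mnm_lepP le_mk_mi.
transitivity (\sum_(mj : 'X_{1..n < b} | (mj <= mi - mk)%MM) coef3 mj mk).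
+ apply/eq_bigl=> m /=.
  apply/idP/idP => [/andP[/mnm_lepP le1 /mnm_lepP le2]|le1].
  * apply/mnm_lepP => i; rewrite mnmBE /leq subnBA // addnC -subnBA //.
    by rewrite -mnmBE; apply/le2.
  * have le2: (m <= mi)%MM by rewrite (lepm_trans le1) ?lem_subr.
    rewrite le2; apply/mnm_lepP=> i; rewrite mnmBE /leq.
    move/mnm_lepP: le2 => le2; rewrite subnBA // addnC.
    by rewrite -subnBA //; move/mnm_lepP/(_ i): le1; rewrite mnmBE.
rewrite -[X in _ * X]/(series_mul p q (mi - mk)%MM) (@series_mulE _ _ _ b) //.
rewrite mulr_sumr; apply: eq_bigr => mj _.
by rewrite /coef3 mulrCA !submDA addmC.
Qed.

Lemma series_mul1 : left_id (series_const 1) series_mul.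
Proof.
move=> f; apply/seriesP => m /=.
rewrite (bigD1 (bm0 : 'X_{1..n < (mdeg m).+1})) /=; last first.
  by apply/mnm_lepP => i; rewrite mnm0E.
rewrite eqxx mul1r subm0 big1 ?addr0 // => k /andP[_ /negbTE].
by rewrite eqE /= => ->; rewrite mul0r.
Qed.

Lemma series_mulDl : left_distributive series_mul series_add.
Proof.
move=> f g h; apply/seriesP => m /=; rewrite -big_split /=.
by apply: eq_bigr => k _; rewrite mulrDl.
Qed.

HB.instance Definition _ := GRing.Zmodule_isComPzRing.Build {series R[n]}
  series_mulA series_mulC series_mul1 series_mulDl.

Definition series_var (i : 'I_n) : {series R[n]} :=
  Series (fun m => if m == U_(i)%MM then 1 else 0).

End SeriesRing.

Arguments series_const {n R} c.
Arguments series_var {n R} i.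

(* Substitution F(g_0, ..., g_(n-1)).  It is meaningful when every g_i has
   constant term 0: the powers g ^ k with mdeg k > mdeg m then have no
   monomial m, so that the finite sum below is the full one.  *)
Definition series_subst n k (R : comPzRingType) (F : {series R[n]})
    (g : n.-tuple {series R[k]}) : {series R[k]} :=
  Series (fun m => \sum_(p : 'X_{1..n < (mdeg m).+1})
                     F p * (\prod_(i < n) tnth g i ^+ p i) m).

Notation "F \So g" := (series_subst F g) (at level 50) : ring_scope.

Definition series_map n (R S : Type) (phi : R -> S) (F : {series R[n]}) :
  {series S[n]} := Series (fun m => phi (F m)).

(* The element q with q * b = a, when there is one (0 otherwise).  *)
Definition exact_quot (T : comPzRingType) (a b : T) : T :=
  xget 0 (fun q => q * b = a).

(* The square root with constant term 1, when there is one (0 otherwise).  *)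
Definition series_sqrt n (R : comPzRingType) (f : {series R[n]}) :
  {series R[n]} := xget 0 (fun s : {series R[n]} => s 0%MM = 1 /\ s ^+ 2 = f).

(* ------------------------------------------------------------------------ *)
(* The Buchstaber formal group law over R, with parameters in R.             *)
Section BuchstaberLaw.
Variables (R : comPzRingType) (a1 a2 a3 : R).
Local Notation C := series_const.
Local Notation t := (series_var 0 : {series R[1]}).
Local Notation u := (series_var 0 : {series R[2]}).
Local Notation v := (series_var 1 : {series R[2]}).

Definition Bc_Q : {series R[1]} :=
  1 - C a1 * t ^+ 2 + C a2 * t ^+ 4 - C a3 * t ^+ 6.

Definition Bc_H : {series R[2]} :=
  exact_quot (u * (series_sqrt Bc_Q \So [tuple v])
              - v * (series_sqrt Bc_Q \So [tuple u])) (u - v).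

Definition Bc_law : {series R[2]} :=
  exact_quot (u + v)
    (series_sqrt (Bc_H ^+ 2 + C a3 * u ^+ 2 * v ^+ 2 * (u + v) ^+ 2)).

End BuchstaberLaw.

Notation R_Bc := {mpoly Zhalf[3]}.

Definition F_Bc : {series R_Bc[2]} :=
  Bc_law 'X_0 'X_1 'X_2.

(* ------------------------------------------------------------------------ *)
(* Existence and uniqueness for the square roots and quotients above, when   *)
(* 2 is invertible: exact_quot and series_sqrt never take their default.     *)
Lemma exact_quotP (T : comPzRingType) (a b q : T) : injective ( *%R^~ b) ->
  q * b = a -> exact_quot a b = q.
Proof. by move=> inj_b qb; apply: xget_unique => // q'; rewrite -qb => /inj_b. Qed.

Section SeriesFacts.
Variables (n : nat) (R : comPzRingType).
Implicit Types f g e : {series R[n]}.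

Lemma scoef0 m : (0 : {series R[n]}) m = 0. Proof. by rewrite /= if_same. Qed.
Lemma scoef1 m : (1 : {series R[n]}) m = if m == 0%MM then 1 else 0.
Proof. by []. Qed.
Lemma scoefD f g m : (f + g) m = f m + g m. Proof. by []. Qed.
Lemma scoefN f m : (- f) m = - f m. Proof. by []. Qed.
Lemma scoefM f g m : (f * g) m =
  \sum_(k : 'X_{1..n < (mdeg m).+1} | (k <= m)%MM) f k * g (m - k)%MM.
Proof. by []. Qed.

Definition slow (d : nat) f : Prop := forall m, (mdeg m < d)%N -> f m = 0.

Lemma slowM a b f g : slow a f -> slow b g -> slow (a + b) (f * g).
Proof.
move=> fa gb m ltm; rewrite scoefM big1 // => k km.
have [ka|ka] := ltnP (mdeg k) a; first by rewrite fa ?mul0r.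
rewrite gb ?mulr0 // -(ltn_add2l (mdeg k)) -mdegD addmC submK //.
by apply: (leq_trans ltm); rewrite leq_add2r.
Qed.

Lemma slowMl a f g : slow a f -> slow a (g * f).
Proof. by rewrite -[a]add0n; apply: slowM. Qed.

Lemma slowD a f g : slow a f -> slow a g -> slow a (f + g).
Proof. by move=> fa ga m ma; rewrite scoefD fa ?ga ?addr0. Qed.

Lemma slowN a f : slow a f -> slow a (- f).
Proof. by move=> fa m ma; rewrite scoefN fa ?oppr0. Qed.

Lemma slowW a b f : (a <= b)%N -> slow b f -> slow a f.
Proof. by move=> ab fb m ma; apply: fb; apply: leq_trans ab. Qed.

Lemma slow_eq0 f : (forall d, slow d f) -> f = 0.
Proof. by move=> f0; apply/seriesP => m; rewrite scoef0 (f0 (mdeg m).+1). Qed.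

Lemma slow1 f : f 0%MM = 1 -> slow 1 (1 - f).
Proof.
move=> f1 m; rewrite ltnS leqn0 mdeg_eq0 => /eqP ->.
by rewrite scoefD scoefN f1 scoef1 eqxx subrr.
Qed.

Lemma slow_lim (G : nat -> {series R[n]}) :
  (forall k, slow k.+1 (G k.+1 - G k)) ->
  exists g, forall k, slow k.+1 (g - G k).
Proof.
move=> Gk; exists (Series (fun m => G (mdeg m) m)) => k m.
rewrite ltnS scoefD scoefN /= => /subnKC <-.
elim: (k - mdeg m)%N => [|j IH]; first by rewrite addn0 subrr.
have /(_ m) := Gk (mdeg m + j)%N; rewrite ltnS leq_addr scoefD scoefN => /(_ isT).
by move/eqP; rewrite subr_eq0 addnS => /eqP ->.
Qed.

Lemma scoefM0 f g : (f * g) 0%MM = f 0%MM * g 0%MM.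
Proof.
rewrite scoefM mdeg0 (bigD1 (bm0 : 'X_{1..n < 1})) /=; last first.
  by apply/mnm_lepP => i.
rewrite subm0 big1 ?addr0 // => k /andP[_ /negP[]].
by rewrite eqE /= -mdeg_eq0 -leqn0 -ltnS bmdeg.
Qed.

Lemma series_inv f : f 0%MM = 1 -> exists g, g * f = 1.
Proof.
move=> f1; set e := 1 - f; have e1 := slow1 f1.
have eX k : slow k (e ^+ k).
  elim: k => [m|k IH]; first by rewrite ltn0.
  by rewrite exprSr -addn1; apply: slowM.
have [|g gP] := @slow_lim (fun k => \sum_(i < k.+1) e ^+ i).
  by move=> k; rewrite [X in X - _]big_ord_recr /= addrAC subrr add0r; apply: eX.
exists g; apply/eqP; rewrite -subr_eq0; apply/eqP/slow_eq0 => d.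
set s := \sum_(i < d.+1) e ^+ i.
have -> : g * f - 1 = f * (g - s) - e ^+ d.+1.
  have fs : f * s = 1 - e ^+ d.+1.
    by rewrite -opprB subrX1 -mulNr opprB /e opprB addrC subrK.
  by rewrite mulrBr fs mulrC opprB addrA addrAC addrK.
by apply: slowD; [apply: slowMl|apply: slowN]; apply: (@slowW _ d.+1).
Qed.

Lemma series_reg f : f 0%MM = 1 -> injective ( *%R^~ f).
Proof.
move=> /series_inv[g gf] a b /= ab.
by rewrite -[a]mulr1 -[b]mulr1 -gf mulrCA ab mulrCA.
Qed.

Lemma exact_quotK a f : f 0%MM = 1 -> exact_quot a f * f = a.
Proof.
move=> f1; have [g gf] := series_inv f1.
have q : a * g * f = a by rewrite -mulrA gf mulr1.
by rewrite (exact_quotP (series_reg f1) q).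
Qed.

Lemma series_sqrt_ex f : (exists h : R, h + h = 1) -> f 0%MM = 1 ->
  exists s : {series R[n]}, s 0%MM = 1 /\ s ^+ 2 = f.
Proof.
move=> [h hh] f1; pose c : {series R[n]} := series_const h.
have cc : c + c = 1.
  apply/seriesP => m; rewrite scoefD scoef1 /=.
  by case: ifP; rewrite ?addr0.
pose G := fix G k : {series R[n]} :=
    if k is k'.+1 then G k' + c * (f - G k' ^+ 2) else 1.
have GP k : slow 1 (1 - G k) /\ slow k.+1 (f - G k ^+ 2).
  elim: k => [|k [IH1 IH2]] /=.
    split; first by rewrite subrr => m _; rewrite scoef0.
    by rewrite expr1n -opprB; apply/slowN/slow1.
  split.
    rewrite opprD addrA; apply: slowD => //; apply/slowN/slowMl.
    exact: slowW IH2.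
  set e := f - _ in IH2 *; set s := G k in IH1 e IH2 *.
  have -> : f - (s + c * e) ^+ 2 = (1 - s) * e + - ((c * e) * (c * e)).
    have -> : f = e + s ^+ 2 by rewrite /e subrK.
    have sce : s * (c * e) *+ 2 = s * e.
      by rewrite mulr2n -mulrDr -mulrDl cc mul1r.
    by rewrite sqrrD sce -(expr2 (c * e)) mulrBl mul1r !opprD !addrA addrK.
  apply: slowD; first by rewrite -add1n; apply: slowM.
  apply: slowN; apply: (@slowW _ (k.+1 + k.+1)); first by rewrite addSn ltnS leq_addl.
  by apply: slowM; apply: slowMl.
have [|s sP] := @slow_lim G.
  by move=> k /=; rewrite addrAC subrr add0r; apply: slowMl; case: (GP k).
exists s; split.
  have /(_ 0%MM) := sP 0%N; rewrite mdeg0 scoefD scoefN /= eqxx => /(_ isT).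
  by move/eqP; rewrite subr_eq0 => /eqP.
apply/eqP; rewrite -subr_eq0; apply/eqP/slow_eq0 => d.
apply: (@slowW _ d.+1) => //.
have -> : s ^+ 2 - f = (s + G d) * (s - G d) - (f - G d ^+ 2).
  by rewrite mulrC -subr_sqr opprB addrA subrK.
apply: slowD; first exact: slowMl.
by apply: slowN; case: (GP d).
Qed.

Lemma series_sqrtP f : (exists h : R, h + h = 1) -> f 0%MM = 1 ->
  [/\ series_sqrt f 0%MM = 1, series_sqrt f ^+ 2 = f
    & forall s : {series R[n]}, s 0%MM = 1 -> s ^+ 2 = f -> series_sqrt f = s].
Proof.
move=> hR f1; have [s [s1 sf]] := series_sqrt_ex hR f1.
have uniq_s (s' : {series R[n]}) : s' 0%MM = 1 /\ s' ^+ 2 = f -> s' = s.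
  move=> [s'1 s'f]; have [h hh] := hR.
  pose w := series_const h * (s' + s).
  have w1 : w 0%MM = 1 by rewrite scoefM0 scoefD s1 s'1 /= eqxx mulrDr mulr1.
  apply/eqP; rewrite -subr_eq0; apply/eqP/(series_reg w1).
  by rewrite mul0r mulrCA -subr_sqr s'f sf subrr mulr0.
have e : series_sqrt f = s by apply: xget_unique.
by rewrite e; split=> // s' s'1 s'f; apply/esym/uniq_s.
Qed.

Lemma series_varM i f m :
  (series_var i * f) m = if m i == 0%N then 0 else f (m - U_(i))%MM.
Proof.
rewrite scoefM; case: ifP => mi.
  rewrite big1 // => k /mnm_lepP/(_ i); rewrite (eqP mi) leqn0 => ki /=.
  case: eqP => [ki'|_]; last by rewrite mul0r.
  by move: ki; rewrite ki' mnm1E eqxx.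
have Um : (U_(i) <= m)%MM by rewrite lep1mP mi.
have Ud : (mdeg U_(i)%MM < (mdeg m).+1)%N.
  by rewrite -(submK Um) mdegD ltnS leq_addl.
rewrite (bigD1 (BMultinom Ud)) //= eqxx mul1r big1 ?addr0 // => k /andP[_].
by rewrite eqE /= => /negbTE ->; rewrite mul0r.
Qed.

Lemma series_varX i p m :
  (series_var i ^+ p : {series R[n]}) m = if m == (U_(i) *+ p)%MM then 1 else 0.
Proof.
elim: p m => [|p IH] m; first by rewrite expr0 mulm0n.
rewrite exprS series_varM IH; case: (boolP (m i == 0%N)) => mi.
  case: eqP => // mE; move: mi.
  by rewrite mE mulmS mnmDE mnm1E eqxx.
have Um : (U_(i) <= m)%MM by rewrite lep1mP mi.
by rewrite mulmS -{2}(submK Um) addmC eqm_add2l.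
Qed.

End SeriesFacts.

Section BuchstaberLawFacts.
Variables (R : comPzRingType) (a1 a2 a3 : R).
Hypothesis R_2inv : exists h : R, h + h = 1.

Local Notation u := (series_var 0 : {series R[2]}).
Local Notation v := (series_var 1 : {series R[2]}).

Lemma eq_mnm2 (m m' : 'X_{1..2}) :
  (m == m') = (m (0%R : 'I_2) == m' (0%R : 'I_2))
              && (m (1%R : 'I_2) == m' (1%R : 'I_2)).
Proof.
apply/eqP/andP => [-> //|[/eqP m0 /eqP m1]].
apply/mnmP => -[[|[|i]] lti] //.
  by rewrite (_ : Ordinal lti = 0%R) //; apply: val_inj.
by rewrite (_ : Ordinal lti = 1%R) //; apply: val_inj.
Qed.

Lemma subst_var n (q : {series R[1]}) (i : 'I_n) m :
  (q \So [tuple series_var i]) m =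
  if m == (U_(i) *+ m i)%MM then q (U_((0%R : 'I_1)) *+ m i)%MM else 0.
Proof.
have term (p : 'X_{1..1}) :
    (\prod_(j < 1) tnth [tuple series_var i : {series R[n]}] j ^+ p j) m =
    if m == (U_(i) *+ p (0%R : 'I_1))%MM then 1 else 0.
  rewrite big_ord1 (_ : ord0 = 0%R) //; first exact: series_varX.
rewrite /=; under eq_bigr do rewrite term.
case: eqP => mE; last first.
  rewrite big1 // => p _; case: eqP => [mp|_]; last by rewrite mulr0.
  by case: mE; rewrite mp mulmnE mnm1E eqxx mul1n.
have Ud : (mdeg (U_((0%R : 'I_1)) *+ m i)%MM < (mdeg m).+1)%N.
  by rewrite mE !mdegMn !mdeg1 mulmnE mnm1E eqxx !mul1n.
rewrite (bigD1 (BMultinom Ud)) //= mulmnE mnm1E eqxx mul1n -mE eqxx mulr1.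
rewrite big1 ?addr0 // => p; rewrite eqE /= => /eqP pE.
case: eqP => [mp|_]; last by rewrite mulr0.
case: pE; apply/mnmP => j; rewrite (ord1 j) mulmnE mnm1E eqxx mul1n.
by move/mnmP/(_ i): mp; rewrite mulmnE mnm1E eqxx mul1n => ->.
Qed.

Lemma var_sub_reg : injective ( *%R^~ (u - v)).
Proof.
move=> f g /= fg; apply/eqP; rewrite -subr_eq0; apply/eqP.
have {fg} : (f - g) * (u - v) = 0 by rewrite mulrBl fg subrr.
move: (f - g) => d; rewrite mulrC mulrBl => /eqP; rewrite subr_eq0 => /eqP uv.
apply/seriesP => m; rewrite scoef0.
move b_def : (m (1%R : 'I_2)) => b; elim: b => [|b IH] in m b_def *.
  have : (u * d) (m + U_(0%R))%MM = (v * d) (m + U_(0%R))%MM by rewrite uv.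
  by rewrite !series_varM !mnmDE !mnm1E b_def /= addn1 /= addmK.
have : (u * d) (m + U_(0%R))%MM = (v * d) (m + U_(0%R))%MM by rewrite uv.
rewrite !series_varM !mnmDE !mnm1E b_def /= addn1 ?addn0 /= addmK => ->.
by apply: IH; rewrite !mnmBE mnmDE !mnm1E b_def /= addn0 subn1.
Qed.

Lemma divided_difference (q : {series R[1]}) : q 0%MM = 1 ->
  exists H : {series R[2]}, H 0%MM = 1 /\
    H * (u - v) = u * (q \So [tuple v]) - v * (q \So [tuple u]).
Proof.
move=> q0; pose qn d := q (U_((0%R : 'I_1)) *+ d)%MM.
have qn0 : qn 0%N = 1 by rewrite /qn mulm0n.
exists (Series (fun m : 'X_{1..2} => if m == 0%MM then 1 else
  if (m (0%R : 'I_2) == 0%N) || (m (1%R : 'I_2) == 0%N) then 0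
  else - qn (m (0%R : 'I_2) + m (1%R : 'I_2))%N)).
split; first by rewrite /= eqxx.
rewrite mulrC mulrBl; apply/seriesP => m.
rewrite !scoefD !scoefN !series_varM !subst_var /= !eq_mnm2 !mulmnE.
rewrite !mnmBE !mnm1E !mnm0E /= -![q _]/(qn _).
case: (m 0) => [|a]; case: (m 1) => [|b] //=;
  rewrite ?subn0 ?mul0n ?mul1n ?subn1 ?qn0 ?eqxx ?orbT ?andbT /= ?subr0 ?sub0r //.
case: a b => [|a] [|b] /=; rewrite ?addn0 ?add0n ?addnS ?addSn /= ?addn0 ?add0n ?subrr ?subr0
  ?sub0r ?opprK // ?addNr.
Qed.

Lemma Bc_Q0 : Bc_Q a1 a2 a3 0%MM = 1.
Proof.
have t0 k c : (series_const c * series_var 0 ^+ k.+1 : {series R[1]}) 0%MM = 0.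
  by rewrite exprSr mulrA scoefM0 [X in _ * X]/= eq_sym mnm1_eq0 mulr0.
by rewrite /Bc_Q !scoefD !scoefN !t0 scoef1 eqxx !(subr0, addr0).
Qed.

Lemma Bc_HP :
  let q := series_sqrt (Bc_Q a1 a2 a3) in
  Bc_H a1 a2 a3 0%MM = 1 /\
  Bc_H a1 a2 a3 * (u - v) = u * (q \So [tuple v]) - v * (q \So [tuple u]).
Proof.
have [q0 _ _] := series_sqrtP R_2inv Bc_Q0.
have [H [H0 HE]] := divided_difference q0.
by rewrite /Bc_H (exact_quotP var_sub_reg HE).
Qed.

Lemma Bc_lawP :
  let W := Bc_H a1 a2 a3 ^+ 2
           + series_const a3 * u ^+ 2 * v ^+ 2 * (u + v) ^+ 2 in
  [/\ series_sqrt W 0%MM = 1, series_sqrt W ^+ 2 = W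
    & Bc_law a1 a2 a3 * series_sqrt W = u + v].
Proof.
move=> W; have W0 : W 0%MM = 1.
  have [H0 _] := Bc_HP.
  rewrite scoefD expr2 scoefM0 H0 mulr1 [(u + v) ^+ 2]expr2 mulrA scoefM0.
  by rewrite scoefD /= ![0%MM == _]eq_sym !mnm1_eq0 addr0 mulr0 addr0.
have [s0 sE _] := series_sqrtP R_2inv W0.
by split=> //; apply: exact_quotK.
Qed.

End BuchstaberLawFacts.

(* ------------------------------------------------------------------------ *)
Section FormalGroups.
Variable S : comPzRingType.
Implicit Type F : {series S[2]}.

Definition is_comm_fgl F : Prop :=
  let u : {series S[2]} := series_var 0 in
  let v : {series S[2]} := series_var 1 in
  let x : {series S[3]} := series_var 0 in
  let y : {series S[3]} := series_var 1 in
  let z : {series S[3]} := series_var 2 in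
  [/\ F \So [tuple u; 0] = u, F \So [tuple 0; v] = v,
      F \So [tuple F \So [tuple x; y]; z] = F \So [tuple x; F \So [tuple y; z]]
    & F \So [tuple v; u] = F].

Definition is_formal_inverse F (i : {series S[1]}) : Prop :=
  i 0%MM = 0 /\ F \So [tuple series_var 0; i] = 0.

(* A two-valued law x * y = [z1, z2] is given by the elementary symmetric
   functions T1 = z1 + z2 and T2 = z1 z2 of its values, in S[[x, y]].
   For a formal group law F with formal inverse i, its modulus square is the
   one for which T1 and T2 are the following series in x = u i(u) and
   y = v i(v).  *)
Definition is_modulus_square F (i : {series S[1]}) (T1 T2 : {series S[2]}) :
  Prop :=
  let u : {series S[2]} := series_var 0 in
  let v : {series S[2]} := series_var 1 in
  let ubar := i \So [tuple u] in
  let vbar := i \So [tuple v] in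
  let z1 := (F \So [tuple u; v]) * (F \So [tuple ubar; vbar]) in
  let z2 := (F \So [tuple u; vbar]) * (F \So [tuple ubar; v]) in
  T1 \So [tuple u * ubar; v * vbar] = z1 + z2 /\
  T2 \So [tuple u * ubar; v * vbar] = z1 * z2.

Definition Bc_family (T : comPzRingType) (alpha1 alpha2 alpha3 z x y : T) : T :=
  (x + y + z - alpha2 * x * y * z) ^+ 2
  - 4 * (1 + alpha3 * x * y * z)
      * (x * y + y * z + x * z + alpha1 * x * y * z).

(* B_alpha(z; x, y) in S[[x, y, z]], which contains S[[x, y]][z]; the variables
   x, y, z have the indices 0, 1, 2.  *)
Definition Bc_series (alpha1 alpha2 alpha3 : S) : {series S[3]} :=
  Bc_family (series_const alpha1) (series_const alpha2) (series_const alpha3)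
    (series_var 2) (series_var 0) (series_var 1).

(* The coefficient of z ^ 2 in B_alpha, as a series in x and y.  *)
Definition Bc_lead (alpha1 alpha2 alpha3 : S) : {series S[2]} :=
  Series (fun m =>
    Bc_series alpha1 alpha2 alpha3 [multinom [tuple m 0; m 1; 2%N]]).

Lemma Bc_family_mod (T : comPzRingType) (c1 c2 c3 z x y : T) :
  exists A B, Bc_family c1 c2 c3 z x y = z ^+ 2 + (x * A + y * B).
Proof.
pose r := 1 + c3 * x * y * z; pose d := 1 - c2 * y * z.
exists (d * (x * d + y + 2 * z) - 4 * r * (y + z + c1 * y * z)).
exists (x * d + y + 2 * z - 4 * r * z).
by rewrite /Bc_family /r /d; ring.
Qed.

Lemma Bc_lead0 alpha1 alpha2 alpha3 : Bc_lead alpha1 alpha2 alpha3 0%MM = 1.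
Proof.
pose m : 'X_{1..3} :=
  [multinom [tuple (0%MM : 'X_{1..2}) 0%R; (0%MM : 'X_{1..2}) 1%R; 2%N]].
rewrite -[LHS]/(Bc_series alpha1 alpha2 alpha3 m) /Bc_series.
have [A [B ->]] := Bc_family_mod (series_const alpha1) (series_const alpha2)
  (series_const alpha3) (series_var 2 : {series S[3]}) (series_var 0) (series_var 1).
have m0 : m 0%R = 0%N by rewrite /m multinomE (tnth_nth 0%N) /= mnm0E.
have m1 : m 1%R = 0%N by rewrite /m multinomE (tnth_nth 0%N) /= mnm0E.
rewrite !scoefD series_varX !series_varM m0 m1 !addr0 ifT //.
apply/eqP/mnmP => i; rewrite mulmnE mnm1E multinomE (tnth_nth 0%N).
by case: i => [[|[|[|]]]] //= _; rewrite mnm0E.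
Qed.

Lemma Bc_lead_inv alpha1 alpha2 alpha3 :
  exact_quot 1 (Bc_lead alpha1 alpha2 alpha3) * Bc_lead alpha1 alpha2 alpha3 = 1.
Proof. exact/exact_quotK/Bc_lead0. Qed.

(* z ^ 2 - T1 z + T2 = C ^ -1 * B_alpha(z; x, y): the law with symmetric
   functions T1 and T2 is G_alpha.  *)
Definition is_Bc_two_valued (alpha1 alpha2 alpha3 : S)
    (T1 T2 : {series S[2]}) : Prop :=
  let x : {series S[3]} := series_var 0 in
  let y : {series S[3]} := series_var 1 in
  let z : {series S[3]} := series_var 2 in
  z ^+ 2 - (T1 \So [tuple x; y]) * z + (T2 \So [tuple x; y])
  = (exact_quot 1 (Bc_lead alpha1 alpha2 alpha3) \So [tuple x; y])
    * Bc_series alpha1 alpha2 alpha3.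

Definition modulus_square_is_Bc F (i : {series S[1]})
    (alpha1 alpha2 alpha3 : S) : Prop :=
  exists T1 T2 : {series S[2]},
    is_modulus_square F i T1 T2 /\ is_Bc_two_valued alpha1 alpha2 alpha3 T1 T2.

Definition Bc_kind F : Prop :=
  let minus : {series S[1]} := - series_var 0 in
  [/\ is_comm_fgl F, is_formal_inverse F minus
    & exists alpha1 alpha2 alpha3 : S,
        modulus_square_is_Bc F minus alpha1 alpha2 alpha3].

End FormalGroups.

(* Main.v *)
(* F_Bc is the group law with invariant differential du / sqrt (Q u).  Over the
   torsion-free ring R_Bc, associativity follows from uniqueness for first-order
   transport equations.  The derivation sqrt (Q u) d/du - sqrt (Q v) d/dv kills
   F_Bc, hence it kills sqrt (Q F_Bc) - sqrt (Q u) dF_Bc/du, which vanishes at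
   v = 0 and so is 0; therefore sqrt (Q x) d/dx - sqrt (Q y) d/dy kills both
   F (F (x, y), z) and F (x, F (y, z)), which agree at y = 0.

   With U = u ^ 2, V = v ^ 2, B_alpha (- A; - U, - V) = D A ^ 2 - 2 E A + (U - V) ^ 2
   where E ^ 2 - D (U - V) ^ 2 = 4 U V Q(u) Q(v).  So for a law F of the given
   kind A = F ^ 2 satisfies
     (D A - E - w) (D A - E + w) = 0,  w = 2 u v sqrt (Q u) sqrt (Q v),
   in which the second factor 4 u v + ... is not a zero divisor, even when S has
   torsion or zero divisors.  Hence F ^ 2 = (E + w) / D = F_Bc ^ 2 for the
   parameters alpha, and F = F_Bc because F + F_Bc = 2 (u + v) + ... is not a zero
   divisor either.  *)
From HB Require Import structures.
Require Import Defs.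
From mathcomp Require Import all_boot all_order all_algebra.
From mathcomp Require Import mpoly ring.
Set Implicit Arguments.
Unset Strict Implicit.
Unset Printing Implicit Defensive.
Import GRing.Theory.
Local Open Scope ring_scope.

(** * Substitution and derivation of power series *)

Lemma additive0 (U V : zmodType) (X : U -> V) :
  (forall a b, X (a + b) = X a + X b) -> X 0 = 0.
Proof.
move=> XD; have /eqP := XD 0 0.
by rewrite addr0 -subr_eq0 opprD addrA subrr sub0r oppr_eq0 => /eqP.
Qed.

Lemma additiveN (U V : zmodType) (X : U -> V) :
  (forall a b, X (a + b) = X a + X b) -> forall a, X (- a) = - X a.
Proof.
by move=> XD a; apply/eqP; rewrite -addr_eq0 -XD addNr (additive0 XD).
Qed.

Section Monomials.
Variables (n : nat) (R : comPzRingType).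
Implicit Types (f g h : {series R[n]}) (m p q : 'X_{1..n}).

Definition smon p : {series R[n]} := Series (fun m => if m == p then 1 else 0).

Lemma scoef_sum (I : Type) (r : seq I) (P : pred I) (F : I -> {series R[n]}) m :
  (\sum_(i <- r | P i) F i) m = \sum_(i <- r | P i) F i m.
Proof. by apply: (big_morph (fun f => f m)) => //; rewrite scoef0. Qed.

Lemma scoefMn f k m : (f *+ k) m = f m *+ k.
Proof. by elim: k => [|k IH]; rewrite ?scoef0 // !mulrS scoefD IH. Qed.

Lemma smonME p f m :
  (smon p * f) m = if (p <= m)%MM then f (m - p)%MM else 0.
Proof.
rewrite scoefM; case: ifP => pm; last first.
  rewrite big1 // => k km /=; case: eqP => [kp|_]; last by rewrite mul0r.
  by move: km; rewrite kp pm.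
have pd : (mdeg p < (mdeg m).+1)%N by rewrite -(submK pm) mdegD ltnS leq_addl.
rewrite (bigD1 (BMultinom pd)) //= eqxx mul1r big1 ?addr0 // => k /andP[_].
by rewrite eqE /= => /negbTE ->; rewrite mul0r.
Qed.

Lemma smon0 : smon 0%MM = 1. Proof. by []. Qed.

Lemma smonM p q : smon p * smon q = smon (p + q)%MM.
Proof.
apply/seriesP => m; rewrite smonME /=; case: ifP => pm.
  by rewrite -{2}(submK pm) addmC eqm_add2l.
by case: eqP => // mE; move: pm; rewrite mE lem_addr.
Qed.

Lemma smon_prod p : smon p = \prod_(i < n) series_var i ^+ p i.
Proof.
have varX i k : series_var i ^+ k = smon (U_(i) *+ k)%MM.
  by apply/seriesP => m; rewrite series_varX.
rewrite {1}[p]multinomUE_id.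
rewrite (big_morph smon (fun a b => esym (smonM a b)) smon0).
by apply: eq_bigr => i _; rewrite varX.
Qed.

Lemma scoefCM c f m : (series_const c * f) m = c * f m.
Proof.
rewrite scoefM (bigD1 (bm0 : 'X_{1..n < (mdeg m).+1})) /=; last first.
  by apply/mnm_lepP => i; rewrite mnm0E.
rewrite eqxx subm0 big1 ?addr0 // => k /andP[_ /negbTE].
by rewrite eqE /= => ->; rewrite mul0r.
Qed.

Lemma series_constM c d : series_const c * series_const d = series_const (c * d) :> {series R[n]}.
Proof.
by apply/seriesP => m; rewrite scoefCM /=; case: ifP; rewrite ?mulr0.
Qed.

Lemma slowX f k : slow 1 f -> slow k (f ^+ k).
Proof.
move=> f1; elim: k => [m|k IH]; first by rewrite ltn0.
by rewrite exprSr -addn1; apply: slowM.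
Qed.

Lemma slow1E f : slow 1 f <-> f 0%MM = 0.
Proof.
split=> [f1|f0 m]; first by apply: f1; rewrite mdeg0.
by rewrite ltnS leqn0 mdeg_eq0 => /eqP ->.
Qed.

End Monomials.
Arguments smon {n R} p.

(** * Additive maps between power series rings that are continuous for the order *)

Section Continuity.
Variables (n k : nat) (R : comPzRingType).
Implicit Types Phi Psi : {series R[n]} -> {series R[k]}.

(** Such maps lower the order by at most [s]. Substitutions have [s = 0], partial derivatives
    [s = 1], and extraction of the coefficient of [z ^ j] has [s = j]. *)
Definition scont s Phi : Prop :=
  (forall f h, Phi (f + h) = Phi f + Phi h) /\
  (forall d f, slow (d + s) f -> slow d (Phi f)).

(** Modulo order [d + s] a series is a finite sum of terms [c x ^ p], and the remainder contributes
    only in order at least [d]. Identities such as the product and chain rules are thereby reduced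
    to monomials. *)
Lemma scont_eq s Phi Psi : scont s Phi -> scont s Psi ->
  (forall c p, Phi (series_const c * smon p) = Psi (series_const c * smon p)) ->
  Phi =1 Psi.
Proof.
move=> [PhiD Phis] [PsiD Psis] e f.
apply/eqP; rewrite -subr_eq0; apply/eqP/slow_eq0 => d.
pose t := \sum_(p : 'X_{1..n < d + s}) series_const (f p) * smon p : {series R[n]}.
have ft : slow (d + s) (f - t).
  move=> m md; rewrite scoefD scoefN scoef_sum (bigD1 (BMultinom md)) //.
  rewrite scoefCM [smon _ _]/= eqxx mulr1 big1 => [|p]; first by rewrite /= addr0 subrr.
  move=> pm; have {}pm : val p != m by [].
  by rewrite scoefCM [smon _ _]/= eq_sym (negbTE pm) mulr0.
have et : Phi t = Psi t.
  rewrite /t; elim/big_rec: _ => [|p x _ IH]; 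
    first by rewrite (additive0 PhiD) (additive0 PsiD).
  by rewrite PhiD PsiD e IH.
rewrite -(subrK t f) PhiD PsiD et opprD addrACA subrr addr0.
by apply: slowD; [apply: Phis|apply/slowN/Psis].
Qed.

Lemma scontMr s Phi g : scont s Phi -> scont s (fun f => Phi f * g).
Proof.
move=> [PhiD Phis]; split=> [f h|d f fd]; first by rewrite PhiD mulrDl.
by rewrite mulrC; apply/slowMl/Phis.
Qed.

Lemma scontMl s Phi g : scont s Phi -> scont s (fun f => g * Phi f).
Proof.
move=> [PhiD Phis]; split=> [f h|d f fd]; first by rewrite PhiD mulrDr.
exact/slowMl/Phis.
Qed.

Lemma scont_arg s Phi g : scont s Phi -> scont s (fun f => Phi (g * f)).
Proof.
move=> [PhiD Phis]; split=> [f h|d f fd]; first by rewrite mulrDr PhiD.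
exact/Phis/slowMl.
Qed.

Lemma scont_argr s Phi g : scont s Phi -> scont s (fun f => Phi (f * g)).
Proof.
move=> [PhiD Phis]; split=> [f h|d f fd]; first by rewrite mulrDl PhiD.
by apply: Phis; rewrite mulrC; apply: slowMl.
Qed.

Lemma scontD s Phi Psi : scont s Phi -> scont s Psi ->
  scont s (fun f => Phi f + Psi f).
Proof.
move=> [PhiD Phis] [PsiD Psis]; split=> [f h|d f fd].
  by rewrite PhiD PsiD addrACA.
by apply: slowD; [apply: Phis|apply: Psis].
Qed.

Lemma scont_sum (I : Type) (r : seq I) s (F : I -> {series R[n]} -> {series R[k]}) :
  (forall i, scont s (F i)) -> scont s (fun f => \sum_(i <- r) F i f).
Proof.
move=> Fs; split=> [f h|d f fd].
  by rewrite -big_split; apply: eq_bigr => i _; case: (Fs i).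
elim/big_rec: _ => [m _|i x _ xd]; first by rewrite scoef0.
by apply: slowD => //; case: (Fs i) => _; apply.
Qed.

End Continuity.

Lemma scont_comp n k l (R : comPzRingType) s t
    (Phi : {series R[n]} -> {series R[k]}) (Psi : {series R[k]} -> {series R[l]}) :
  scont s Phi -> scont t Psi -> scont (t + s) (Psi \o Phi).
Proof.
move=> [PhiD Phis] [PsiD Psis]; split=> [f h|d f] /=; first by rewrite PhiD PsiD.
by rewrite addnA => /Phis/Psis.
Qed.

Lemma scont_id n (R : comPzRingType) : scont 0 (@id {series R[n]}).
Proof. by split=> // d f; rewrite addn0. Qed.

(** * Substitution as a ring morphism *)

Section Substitution.
Variables (n k : nat) (R : comPzRingType).
Implicit Types (f h : {series R[n]}) (g : n.-tuple {series R[k]}).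

(** Under this condition the finite sum that defines [\So] drops no term, so [\So] is the genuine
    substitution. *)
Definition zero_const g : Prop := forall i, tnth g i 0%MM = 0.

Definition spow g (p : 'X_{1..n}) := \prod_(i < n) tnth g i ^+ p i.

Lemma scoef_subst f g m :
  (f \So g) m = \sum_(p : 'X_{1..n < (mdeg m).+1}) f p * spow g p m.
Proof. by []. Qed.

(** Every factor [tnth g i] has order at least 1. Hence exponents [p] outside the range of the sum
    in [\So] contribute nothing. *)
Lemma slow_spow g p : zero_const g -> slow (mdeg p) (spow g p).
Proof.
move=> g0; rewrite mdegE /spow; elim/big_rec2: _ => [m|i x d _ xd].
  by rewrite ltn0.
by apply: slowM => //; apply/slowX/slow1E/g0.
Qed.

Lemma spowD g p q : spow g (p + q)%MM = spow g p * spow g q.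
Proof.
rewrite /spow -big_split; apply: eq_bigr => i _.
by rewrite mnmDE exprD.
Qed.

Lemma substZ c f g : (series_const c * f) \So g = series_const c * (f \So g).
Proof.
apply/seriesP => m; rewrite scoefCM !scoef_subst mulr_sumr.
by apply: eq_bigr => p _; rewrite scoefCM mulrA.
Qed.

Lemma scont_subst g : scont 0 (fun f => f \So g).
Proof.
split=> [f h|d f]; last first.
  rewrite addn0 => fd m md; rewrite scoef_subst big1 // => p _.
  by rewrite fd ?mul0r // (leq_trans (bmdeg p)).
apply/seriesP => m; rewrite scoefD !scoef_subst -big_split.
by apply: eq_bigr => p _; rewrite scoefD mulrDl.
Qed.

Variable g : n.-tuple {series R[k]}.
Hypothesis g0 : zero_const g.

Lemma subst_smon p : smon p \So g = spow g p.
Proof.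
apply/seriesP => m; rewrite scoef_subst.
have [pm|pm] := ltnP (mdeg p) (mdeg m).+1.
  rewrite (bigD1 (BMultinom pm)) //= eqxx mul1r big1 ?addr0 // => q.
  by rewrite eqE /= => /negbTE ->; rewrite mul0r.
rewrite (slow_spow g0) // big1 // => q _.
rewrite [smon _ _]/=; have [qp|] := eqVneq (val q) p; last by rewrite mul0r.
by move: (bmdeg q); rewrite qp ltnNge pm.
Qed.

Lemma substD f h : (f + h) \So g = (f \So g) + (h \So g).
Proof. by case: (scont_subst g). Qed.

Lemma subst0 : (0 : {series R[n]}) \So g = 0.
Proof. exact: additive0 substD. Qed.

Lemma substN f : (- f) \So g = - (f \So g).
Proof. exact: additiveN substD f. Qed.

Lemma substB f h : (f - h) \So g = (f \So g) - (h \So g).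
Proof. by rewrite substD substN. Qed.

(** Continuity in [f] and then in [h] leaves the case of two monomials, which is [spowD]. *)
Lemma substM f h : (f * h) \So g = (f \So g) * (h \So g).
Proof.
move: f; apply: (@scont_eq _ _ _ 0).
- exact: (scont_argr h (scont_subst g)).
- exact: (scontMr _ (scont_subst g)).
move=> c p; move: h; apply: (@scont_eq _ _ _ 0).
- exact: (scont_arg _ (scont_subst g)).
- exact: (scontMl _ (scont_subst g)).
move=> d q; rewrite mulrACA series_constM smonM !substZ !subst_smon spowD.
by rewrite -series_constM mulrACA.
Qed.

Lemma subst1 : (1 : {series R[n]}) \So g = 1.
Proof.
rewrite -smon0 subst_smon /spow big1 // => i _.
by rewrite mnm0E.
Qed.

Lemma subst_const c : series_const c \So g = series_const c.
Proof. by rewrite -[X in X \So _]mulr1 substZ subst1 mulr1. Qed.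

Lemma substX f j : (f ^+ j) \So g = (f \So g) ^+ j.
Proof. by elim: j => [|j IH]; rewrite ?subst1 // !exprS substM IH. Qed.

Lemma substMn f j : (f *+ j) \So g = (f \So g) *+ j.
Proof. by elim: j => [|j IH]; rewrite ?subst0 // !mulrS substD IH. Qed.

Lemma subst_varE i : series_var i \So g = tnth g i.
Proof.
rewrite -[series_var i]/(smon _) subst_smon /spow (bigD1 i) //= mnm1E eqxx.
rewrite big1 ?mulr1 // => j ji.
by rewrite mnm1E eq_sym (negbTE ji).
Qed.

Lemma scoef0_subst f : (f \So g) 0%MM = f 0%MM.
Proof.
have f00 (a : {series R[n]}) : a 0%MM = 0 -> (a \So g) 0%MM = 0.
  by move=> /slow1E a1; apply/slow1E; case: (scont_subst g) => _; apply.
have /f00/eqP : (f - series_const (f 0%MM)) 0%MM = 0.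
  by rewrite scoefD scoefN /= eqxx subrr.
rewrite substB subst_const.
by rewrite scoefD scoefN /= eqxx subr_eq0 => /eqP.
Qed.

Definition substE :=
  (substD, substN, substM, substX, subst1, subst_const, subst0, substMn).

End Substitution.

(** The composed tuple [gh] is a separate argument, specified componentwise, so that explicit short
    tuples are matched by cases on the index. *)
Lemma subst_comp n k l (R : comPzRingType) (f : {series R[n]})
    (g : n.-tuple {series R[k]}) (h : k.-tuple {series R[l]})
    (gh : n.-tuple {series R[l]}) :
  zero_const g -> zero_const h -> (forall i, tnth gh i = tnth g i \So h) ->
  (f \So g) \So h = f \So gh.
Proof.
move=> g0 h0 ghE.
have gh0 : zero_const gh by move=> i; rewrite ghE scoef0_subst.
move: f; apply: (@scont_eq _ _ _ 0).
- exact: (scont_comp (scont_subst g) (scont_subst h)).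
- exact: scont_subst.
move=> c p; rewrite !substZ !subst_smon //; congr (_ * _).
rewrite /spow (big_morph (fun a => a \So h) (substM h0) (subst1 h0)).
by apply: eq_bigr => i _; rewrite substX // ghE.
Qed.

(** * Partial derivatives, chain rule and transport equations *)

Section Derivation.
Variables (n : nat) (R : comPzRingType) (i : 'I_n).
Implicit Types (f h : {series R[n]}).

Definition sderiv f : {series R[n]} :=
  Series (fun m => f (m + U_(i))%MM *+ (m i).+1).

Lemma scoef_sderiv f m : sderiv f m = f (m + U_(i))%MM *+ (m i).+1.
Proof. by []. Qed.

Lemma sderivD f h : sderiv (f + h) = sderiv f + sderiv h.
Proof. by apply/seriesP => m; rewrite scoefD !scoef_sderiv scoefD mulrnDl. Qed.

Lemma sderiv0 : sderiv 0 = 0.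
Proof. exact: additive0 sderivD. Qed.

Lemma sderivN f : sderiv (- f) = - sderiv f.
Proof. exact: additiveN sderivD f. Qed.

Lemma sderivB f h : sderiv (f - h) = sderiv f - sderiv h.
Proof. by rewrite sderivD sderivN. Qed.

Lemma sderivZ c f : sderiv (series_const c * f) = series_const c * sderiv f.
Proof.
by apply/seriesP => m; rewrite scoefCM !scoef_sderiv scoefCM mulrnAr.
Qed.

Lemma scont_sderiv : scont 1 sderiv.
Proof.
split=> [f h|d f fd m md]; first exact: sderivD.
by rewrite /= fd ?mul0rn // mdegD mdeg1 ltn_add2r.
Qed.

Lemma sderiv_smon p : sderiv (smon p) = smon (p - U_(i))%MM *+ p i.
Proof.
apply/seriesP => m; rewrite scoefMn /=.
case: eqP => [<-|mp]; first by rewrite mnmDE mnm1E eqxx addmK eqxx addn1.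
rewrite mul0rn; case: eqP => [mE|_]; last by rewrite mul0rn.
case: (posnP (p i)) => [->|pi]; first by rewrite mulr0n.
by case: mp; rewrite mE submK // lep1mP -lt0n.
Qed.

Lemma sderivM f h : sderiv (f * h) = sderiv f * h + f * sderiv h.
Proof.
move: f; apply: (@scont_eq _ _ _ 1).
- exact: (scont_argr h scont_sderiv).
- apply: scontD; first exact: (scontMr _ scont_sderiv).
  apply: (@scontMr _ _ _ _ id); split=> // d a; rewrite addn1; exact: slowW.
move=> c p; move: h; apply: (@scont_eq _ _ _ 1).
- exact: (scont_arg _ scont_sderiv).
- apply: scontD; last exact: (scontMl _ scont_sderiv).
  apply: (@scontMl _ _ _ _ id); split=> // d a; rewrite addn1; exact: slowW.
move=> d q; rewrite mulrACA series_constM smonM !sderivZ !sderiv_smon.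
(* When [b i = 0] the truncated subtraction [b - U_(i)] is not the true exponent, but the
   multiplicity [b i] then kills the term. *)
have pq (a b : 'X_{1..n}) :
    smon a * (smon (b - U_(i))%MM *+ b i) = smon (a + b - U_(i))%MM *+ b i :> {series R[n]}.
  rewrite mulrnAr smonM; case: (posnP (b i)) => [->|bi]; first by rewrite !mulr0n.
  by rewrite addmBA // lep1mP -lt0n.
rewrite mnmDE mulrnDr -(pq p q) [(p + q)%MM]addmC -(pq q p) -series_constM.
by move: (_ *+ p i) (_ *+ q i) => x y; ring.
Qed.

Lemma sderiv1 : sderiv 1 = 0.
Proof. by rewrite -smon0 sderiv_smon mnm0E mulr0n. Qed.

Lemma sderiv_const c : sderiv (series_const c) = 0.
Proof. by rewrite -[series_const c]mulr1 sderivZ sderiv1 mulr0. Qed.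

Lemma sderiv_var j : sderiv (series_var j) = (i == j)%:R.
Proof.
rewrite -[series_var j]/(smon _) sderiv_smon mnm1E eq_sym.
case: eqP => [->|]; rewrite ?mulr0n // -smon0; congr (smon _ *+ _).
by apply/mnmP => l; rewrite mnmBE subnn mnm0E.
Qed.

Lemma sderivX f k : sderiv (f ^+ k) = (f ^+ k.-1 * sderiv f) *+ k.
Proof.
elim: k => [|k IH]; first by rewrite sderiv1.
rewrite exprS sderivM IH /= -mulrnAr mulrS mulrnAr mulrC; congr (_ + _).
case: k {IH} => [|k]; first by rewrite !mulr0n mulr0.
by rewrite /= mulrnAr mulrA -exprS.
Qed.

End Derivation.

Lemma sderivC n (R : comPzRingType) i j (f : {series R[n]}) :
  sderiv i (sderiv j f) = sderiv j (sderiv i f).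
Proof.
apply/seriesP => m /=; rewrite -!mulrnA -!addmA [(U_(i) + _)%MM]addmC.
congr (_ *+ _); rewrite !mnmDE !mnm1E [j == i]eq_sym.
by case: eqP => [->|_] //; rewrite !addn0 mulnC.
Qed.

(** The chain rule holds for 1 and for the variables and is stable under products, so it holds for
    monomials; continuity extends it to all series. *)
Lemma sderiv_subst n k (R : comPzRingType) i (f : {series R[n]})
    (g : n.-tuple {series R[k]}) : zero_const g ->
  sderiv i (f \So g) = \sum_j (sderiv j f \So g) * sderiv i (tnth g j).
Proof.
move=> g0.
pose chain a := sderiv i (a \So g) = \sum_j (sderiv j a \So g) * sderiv i (tnth g j).
have chain1 : chain 1.
  rewrite /chain subst1 // sderiv1 big1 // => j _.
  by rewrite sderiv1 subst0 mul0r.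
have chainM a b : chain a -> chain b -> chain (a * b).
  move=> ca cb; rewrite /chain substM // sderivM ca cb mulr_sumr mulr_suml.
  rewrite -big_split; apply: eq_bigr => j _.
  by rewrite sderivM substD !substM //=; ring.
have chainU j : chain (series_var j).
  rewrite /chain subst_varE // (bigD1 j) //= sderiv_var eqxx subst1 // mul1r.
  rewrite big1 ?addr0 // => l /negbTE lj.
  by rewrite sderiv_var lj subst0 mul0r.
move: f; apply: (@scont_eq _ _ _ 1).
- exact: (scont_comp (scont_subst g) (scont_sderiv R i)).
- apply: scont_sum => j; apply: scontMr.
  exact: (scont_comp (scont_sderiv R j) (scont_subst g)).
move=> c p; rewrite substZ sderivZ.
under eq_bigr do rewrite sderivZ substZ -mulrA.
rewrite -mulr_sumr; congr (_ * _); rewrite smon_prod.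
apply: (big_ind chain chain1 chainM) => j _; elim: (p j) => [|e IH]; first exact: chain1.
by rewrite exprS; apply: chainM.
Qed.

(** Setting [x_i = 0] kills exactly the monomials that contain [x_i]. This turns values on a
    coordinate hyperplane into statements about coefficients. *)
Lemma subst_eval0 n (R : comPzRingType) (i : 'I_n) (g : n.-tuple {series R[n]})
    (f : {series R[n]}) (m : 'X_{1..n}) :
  (forall j, tnth g j = if j == i then 0 else series_var j) ->
  m i = 0%N -> (f \So g) m = f m.
Proof.
move=> gE mi.
have term p : spow g p m = (m == p)%:R.
  rewrite -[RHS](_ : smon p m = _); last by rewrite /=; case: eqP.
  rewrite smon_prod; have [pi|pi] := posnP (p i).
    congr (scoef _ _); apply: eq_bigr => j _; rewrite gE.
    by case: eqP => // ->; rewrite pi !expr0.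
  have -> : spow g p = 0.
    by rewrite /spow (bigD1 i) //= gE eqxx expr0n eqn0Ngt pi mul0r.
  rewrite scoef0 -smon_prod /=; case: eqP => // mp.
  by move: pi; rewrite -mp mi.
rewrite scoef_subst (bigD1 (BMultinom (ltnSn (mdeg m)))) //= term eqxx mulr1.
rewrite big1 ?addr0 // => p; rewrite eqE /= => pm.
by rewrite term eq_sym (negbTE pm) mulr0.
Qed.

(* P d_i f = Q d_j f expresses the coefficients of x_i ^ (k + 1) in f through
   those of the lower powers of x_i.  *)
Lemma transport_unique n (R : comPzRingType) (i j : 'I_n) (P Q f : {series R[n]}) :
  (forall (x : R) k, x *+ k.+1 = 0 -> x = 0) -> i != j -> P 0%MM = 1 ->
  P * sderiv i f = Q * sderiv j f -> (forall m : 'X_{1..n}, m i = 0%N -> f m = 0) ->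
  f = 0.
Proof.
move=> tf ij P1 PQ f0; have [P' PP'] := series_inv P1.
(* [van k a] says that [x_i ^ k] divides [a]. *)
pose van k (a : {series R[n]}) := forall m : 'X_{1..n}, (m i < k)%N -> a m = 0.
have vanM k a b : van k b -> van k (a * b).
  move=> bk m mk; rewrite scoefM big1 // => l lm.
  by rewrite bk ?mulr0 // mnmBE (leq_ltn_trans (leq_subr _ _)).
suff fk k : van k f by apply/seriesP => m; rewrite scoef0 (fk (m i).+1).
elim: k => [//|k IH] m; rewrite ltnS leq_eqVlt => /orP[/eqP mk|]; last exact: IH.
case: k IH mk => [|k] IH mk; first exact: f0.
have Um : (U_(i) <= m)%MM by rewrite lep1mP mk.
(* Since [i != j], the derivative in [x_j] preserves divisibility by a power of [x_i], and [P] is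
   invertible. The coefficient of [f] at [m] then vanishes up to the factor [k.+1], which
   torsion-freeness removes. *)
have : van k.+1 (sderiv i f).
  rewrite -[sderiv i f]mul1r -PP' -mulrA PQ; apply/vanM/vanM => q qk /=.
  by rewrite IH ?mul0rn // mnmDE mnm1E eq_sym (negbTE ij) addn0.
move=> /(_ (m - U_(i))%MM) /=; rewrite submK // mnmBE mnm1E eqxx mk subn1 ltnSn.
by move=> /(_ isT) /tf.
Qed.

Lemma ord1_ind (P : 'I_1 -> Prop) : P 0 -> forall i, P i.
Proof. by move=> P0 i; rewrite (ord1 i). Qed.

Lemma ord2_ind (P : 'I_2 -> Prop) : P 0 -> P 1 -> forall i, P i.
Proof.
move=> P0 P1 [[|[|i]] lti] //.
  by rewrite (_ : Ordinal lti = 0) //; apply: val_inj.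
by rewrite (_ : Ordinal lti = 1) //; apply: val_inj.
Qed.

Lemma ord3_ind (P : 'I_3 -> Prop) : P 0 -> P 1 -> P 2 -> forall i, P i.
Proof.
move=> P0 P1 P2 [[|[|[|i]]] lti] //.
- by rewrite (_ : Ordinal lti = 0) //; apply: val_inj.
- by rewrite (_ : Ordinal lti = 1) //; apply: val_inj.
by rewrite (_ : Ordinal lti = 2) //; apply: val_inj.
Qed.

Lemma series_var0 n (R : comPzRingType) (i : 'I_n) :
  (series_var i : {series R[n]}) 0%MM = 0.
Proof. by rewrite /= eq_sym mnm1_eq0. Qed.

Section SmallTuples.
Variables (k : nat) (R : comPzRingType).
Implicit Types a b c : {series R[k]}.

Lemma zero_const1 a : a 0%MM = 0 -> zero_const [tuple a].
Proof. by move=> a0; apply: ord1_ind. Qed.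

Lemma zero_const2 a b : a 0%MM = 0 -> b 0%MM = 0 -> zero_const [tuple a; b].
Proof. by move=> a0 b0; apply: ord2_ind. Qed.

Lemma zero_const3 a b c : a 0%MM = 0 -> b 0%MM = 0 -> c 0%MM = 0 -> zero_const [tuple a; b; c].
Proof. by move=> a0 b0 c0; apply: ord3_ind. Qed.

Lemma subst1_var a : a 0%MM = 0 -> series_var 0 \So [tuple a] = a.
Proof. by move=> a0; rewrite subst_varE //; apply: zero_const1. Qed.

Lemma subst2_var a b : a 0%MM = 0 -> b 0%MM = 0 ->
  (series_var 0 \So [tuple a; b] = a) * (series_var 1 \So [tuple a; b] = b).
Proof. by move=> a0 b0; rewrite !subst_varE //; apply: zero_const2. Qed.

Lemma subst3_var a b c : a 0%MM = 0 -> b 0%MM = 0 -> c 0%MM = 0 ->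
  (series_var 0 \So [tuple a; b; c] = a) * (series_var 1 \So [tuple a; b; c] = b)
  * (series_var 2 \So [tuple a; b; c] = c).
Proof. by move=> a0 b0 c0; rewrite !subst_varE //; apply: zero_const3. Qed.

Lemma subst1_comp l (f : {series R[1]}) a (h : k.-tuple {series R[l]}) :
  a 0%MM = 0 -> zero_const h -> (f \So [tuple a]) \So h = f \So [tuple a \So h].
Proof. by move=> a0 h0; apply: subst_comp => //; [apply: zero_const1|apply: ord1_ind]. Qed.

Lemma subst2_comp l (f : {series R[2]}) a b (h : k.-tuple {series R[l]}) :
  a 0%MM = 0 -> b 0%MM = 0 -> zero_const h ->
  (f \So [tuple a; b]) \So h = f \So [tuple a \So h; b \So h].
Proof.
by move=> a0 b0 h0; apply: subst_comp => //; [apply: zero_const2|apply: ord2_ind].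
Qed.

Lemma sderiv_subst1 i (f : {series R[1]}) a : a 0%MM = 0 ->
  sderiv i (f \So [tuple a]) = (sderiv 0 f \So [tuple a]) * sderiv i a.
Proof. by move=> a0; rewrite sderiv_subst ?big_ord1 //; apply: zero_const1. Qed.

Lemma sderiv_subst2 i (f : {series R[2]}) a b : a 0%MM = 0 -> b 0%MM = 0 ->
  sderiv i (f \So [tuple a; b]) =
  (sderiv 0 f \So [tuple a; b]) * sderiv i a
  + (sderiv 1 f \So [tuple a; b]) * sderiv i b.
Proof.
move=> a0 b0; rewrite sderiv_subst; last exact: zero_const2.
rewrite !big_ord_recl big_ord0 addr0.
by rewrite (_ : ord0 = 0) // (_ : lift _ _ = 1) //; apply: val_inj.
Qed.

Lemma subst1_0 (f : {series R[1]}) : f \So [tuple (0 : {series R[k]})] = series_const (f 0%MM).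
Proof.
apply/seriesP => m; rewrite scoef_subst (bigD1 (bm0 : 'X_{1..1 < (mdeg m).+1})) //=.
rewrite /spow big_ord1 /= mnm0E expr0 scoef1 big1.
  by case: eqP => _; rewrite addr0 ?mulr1 ?mulr0.
move=> p p0; rewrite big_ord1 /= expr0n; case: eqP => [p00|_].
  case/eqP: p0; apply/val_inj/mnmP => i.
  by rewrite (ord1 i) mnm0E [LHS]p00.
by rewrite scoef0 mulr0.
Qed.

End SmallTuples.

(** * Cancellation by regular leading forms *)

Section Regularity.
Variables (n : nat) (R : comPzRingType).
Implicit Types f g h k : {series R[n]}.

(* Multiplication by g shifts the order of every series by exactly d, as for a
   series whose form of lowest degree d is not a zero divisor.  *)
Definition sreg d g : Prop := forall k j, slow (d + j) (g * k) -> slow j k.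

Lemma sregM d e g h : sreg d g -> sreg e h -> sreg (d + e) (g * h).
Proof. by move=> gd he k j; rewrite -mulrA -addnA => /gd/he. Qed.

(** If [k] has order at least [i], then [(f - g) k] has order at least [d + i + 1], so [g k] is as
    small as [f k] in the next degree and the order of [k] rises by one. Induction stops at [j]. *)
Lemma sreg_lead d f g : sreg d g -> slow d.+1 (f - g) -> sreg d f.
Proof.
move=> gd fg k j fk.
suff ki i : (i <= j)%N -> slow i k by apply: ki.
elim: i => [|i IH] ij; first by move=> m; rewrite ltn0.
apply: gd; have -> : g * k = - ((f - g) * k) + f * k by ring.
apply: slowD; last by apply: slowW fk; rewrite leq_add2l.
by apply: slowN; rewrite addnS -addSn; apply: slowM => //; apply/IH/ltnW.
Qed.

Lemma sreg_inj d g k : sreg d g -> g * k = 0 -> k = 0.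
Proof.
move=> gd gk; apply: slow_eq0 => j; apply: gd; rewrite gk => m _.
by rewrite scoef0.
Qed.

Lemma sreg_eq d g a b : sreg d g -> g * a = g * b -> a = b.
Proof.
move=> gd ab; apply/eqP; rewrite -subr_eq0; apply/eqP/(sreg_inj gd).
by rewrite mulrBr ab subrr.
Qed.

Lemma sreg_const c c' : c' * c = 1 -> sreg 0 (series_const c).
Proof.
move=> cc k j /(slowMl (series_const c')).
by rewrite mulrA series_constM cc mul1r.
Qed.

Lemma sreg_unit f : f 0%MM = 1 -> sreg 0 f.
Proof.
move=> f1; apply: (@sreg_lead _ _ (series_const 1)).
  by apply: (@sreg_const _ 1); rewrite mulr1.
by rewrite -opprB; apply/slowN/slow1.
Qed.

Lemma sreg_var i : sreg 1 (series_var i).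
Proof.
move=> k j uk m md; have := uk (m + U_(i))%MM.
rewrite series_varM mnmDE mnm1E eqxx addn1 /= addmK; apply.
by rewrite mdegD mdeg1 addnC ltn_add2l.
Qed.

End Regularity.

(** The coefficient of the product at [m + U_(0)] is [k m] plus [c] times a coefficient of [k] of
    the same degree with a smaller exponent of [v]. Induction on that exponent works over any ring
    because the form is monic in [u]. *)
Lemma sreg_lin (R : comPzRingType) (c : R) :
  sreg 1 (series_var 0 + series_const c * series_var 1 : {series R[2]}).
Proof.
move=> k j uk m; move b_def : (m (1 : 'I_2)) => b.
elim: b => [|b IH] in m b_def * => md.
  have := uk (m + U_(0%R))%MM.
  rewrite mdegD mdeg1 addnC ltn_add2l => /(_ md).
  rewrite mulrDl -mulrA scoefD scoefCM !series_varM !mnmDE !mnm1E b_def /=.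
  by rewrite addn1 /= addmK mulr0 addr0.
have U1 : (U_(1%R) <= m + U_(0%R))%MM by rewrite lep1mP mnmDE b_def.
have mb : (m + U_(0%R) - U_(1%R))%MM (1 : 'I_2) = b.
  by rewrite mnmBE mnmDE !mnm1E b_def /= addn0 subn1.
have md' : (mdeg (m + U_(0%R) - U_(1%R))%MM < j)%N.
  have := congr1 (@mdeg 2) (submK U1).
  by rewrite !mdegD !mdeg1 => /addIn ->.
have := uk (m + U_(0%R))%MM.
rewrite mdegD mdeg1 addnC ltn_add2l => /(_ md).
rewrite mulrDl -mulrA scoefD scoefCM !series_varM !mnmDE !mnm1E b_def /=.
by rewrite addn1 /= addmK (IH _ mb md') mulr0 addr0.
Qed.

(** * Coefficientwise change of the base ring *)

Section SeriesMap.
Variables (n : nat) (R S : comPzRingType) (phi : {rmorphism R -> S}).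
Implicit Types f g : {series R[n]}.

Lemma series_map_zmod : zmod_morphism (series_map phi : {series R[n]} -> _).
Proof. by move=> f g; apply/seriesP => m; rewrite scoefD scoefN /= rmorphB. Qed.

Lemma series_map_monoid : monoid_morphism (series_map phi : {series R[n]} -> _).
Proof.
split=> [|f g]; apply/seriesP => m.
  by rewrite scoef1 /=; case: eqP; rewrite ?rmorph1 ?rmorph0.
rewrite scoefM /= rmorph_sum; apply: eq_bigr => p _; exact: rmorphM.
Qed.

HB.instance Definition _ := GRing.isZmodMorphism.Build _ _
  (series_map phi : {series R[n]} -> _) series_map_zmod.
HB.instance Definition _ := GRing.isMonoidMorphism.Build _ _
  (series_map phi : {series R[n]} -> _) series_map_monoid.

Lemma series_mapD f g :
  series_map phi (f + g) = series_map phi f + series_map phi g.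
Proof. exact: rmorphD. Qed.

Lemma series_mapN f : series_map phi (- f) = - series_map phi f.
Proof. exact: rmorphN. Qed.

Lemma series_mapM f g :
  series_map phi (f * g) = series_map phi f * series_map phi g.
Proof. exact: rmorphM. Qed.

Lemma series_mapX f k : series_map phi (f ^+ k) = series_map phi f ^+ k.
Proof. exact: rmorphXn. Qed.

Lemma series_map1 : series_map phi (1 : {series R[n]}) = 1.
Proof. exact: rmorph1. Qed.

Lemma series_map_const c :
  series_map phi (series_const c : {series R[n]}) = series_const (phi c).
Proof. by apply/seriesP => m /=; case: eqP; rewrite ?rmorph0. Qed.

Lemma series_map_var i :
  series_map phi (series_var i : {series R[n]}) = series_var i.
Proof. by apply/seriesP => m /=; case: eqP; rewrite ?rmorph0 ?rmorph1. Qed.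

End SeriesMap.

Definition series_mapE := (series_mapD, series_mapN, series_mapM, series_mapX,
  series_map1, series_map_const, series_map_var).

Lemma series_map_subst n k (R S : comPzRingType) (phi : {rmorphism R -> S})
    (f : {series R[n]}) (g : n.-tuple {series R[k]}) (h : n.-tuple {series S[k]}) :
  (forall i, tnth h i = series_map phi (tnth g i)) ->
  series_map phi (f \So g) = series_map phi f \So h.
Proof.
move=> hE; apply/seriesP => m; rewrite scoef_subst /= rmorph_sum.
apply: eq_bigr => p _; rewrite rmorphM; congr (_ * _).
rewrite -[LHS]/(series_map phi (spow g p) m) /spow rmorph_prod.
by congr (scoef _ _); apply: eq_bigr => i _; rewrite hE rmorphXn.
Qed.

(** * The Buchstaber law *)

Section Quartics.
Variable T : comPzRingType.
Implicit Types u v p q z U V : T.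

Definition qQ a1 a2 a3 U : T := 1 - a1 * U + a2 * U ^+ 2 - a3 * U ^+ 3.

(** [qE] and [qC] are the E and D of the proof idea: half the middle coefficient and the leading
    coefficient of [Bc_family] at [x = - U], [y = - V]. *)
Definition qE a1 a2 a3 U V : T :=
  U + V - 2 * a1 * U * V + a2 * U * V * (U + V) - 2 * a3 * U ^+ 2 * V ^+ 2.

Definition qC a1 a2 a3 U V : T :=
  (1 - a2 * U * V) ^+ 2 + 4 * a3 * U * V * (U + V - a1 * U * V).

Lemma Bc_familyE a1 a2 a3 z U V :
  Bc_family a1 a2 a3 z (- U) (- V) =
  qC a1 a2 a3 U V * z ^+ 2 + 2 * qE a1 a2 a3 U V * z + (U - V) ^+ 2.
Proof. by rewrite /Bc_family /qC /qE; ring. Qed.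

(** A quarter of the discriminant of the quadratic in [Bc_familyE]. It becomes the square of
    [w = 2 u v p q] once [Q] has square roots [p] and [q]. *)
Lemma qE_disc a1 a2 a3 U V :
  qE a1 a2 a3 U V ^+ 2 - qC a1 a2 a3 U V * (U - V) ^+ 2 =
  4 * U * V * qQ a1 a2 a3 U * qQ a1 a2 a3 V.
Proof. by rewrite /qC /qE /qQ; ring. Qed.

(** The left side is [(u ^ 2 - v ^ 2) ^ 2 / F ^ 2] for the Buchstaber law, so the law is tied to the
    conjugate factor [E - w]. *)
Lemma qE_norm a1 a2 a3 u v p q :
  p ^+ 2 = qQ a1 a2 a3 (u ^+ 2) -> q ^+ 2 = qQ a1 a2 a3 (v ^+ 2) ->
  (u * q - v * p) ^+ 2 + a3 * u ^+ 2 * v ^+ 2 * (u ^+ 2 - v ^+ 2) ^+ 2 =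
  qE a1 a2 a3 (u ^+ 2) (v ^+ 2) - 2 * u * v * p * q.
Proof.
move=> pE qE'.
have -> : (u * q - v * p) ^+ 2 = u ^+ 2 * q ^+ 2 + v ^+ 2 * p ^+ 2 - 2 * u * v * p * q.
  by ring.
by rewrite pE qE' /qE /qQ; ring.
Qed.

Lemma qE_conj a1 a2 a3 u v p q :
  p ^+ 2 = qQ a1 a2 a3 (u ^+ 2) -> q ^+ 2 = qQ a1 a2 a3 (v ^+ 2) ->
  let e := qE a1 a2 a3 (u ^+ 2) (v ^+ 2) in
  (e - 2 * u * v * p * q) * (e + 2 * u * v * p * q) =
  qC a1 a2 a3 (u ^+ 2) (v ^+ 2) * (u ^+ 2 - v ^+ 2) ^+ 2.
Proof.
move=> pE qE' e; apply/eqP; rewrite -subr_eq0; apply/eqP.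
have -> : (e - 2 * u * v * p * q) * (e + 2 * u * v * p * q) =
  e ^+ 2 - 4 * u ^+ 2 * v ^+ 2 * p ^+ 2 * q ^+ 2 by ring.
by rewrite addrAC qE_disc pE qE' subrr.
Qed.

(* D is the invariant derivation sqrt(Q(u)) d/du - sqrt(Q(v)) d/dv; the
   conclusion is 4 M T F D(F) = 0, where M = u ^ 2 - v ^ 2 and F ^ 2 T = M ^ 2.  *)
Lemma derivation_kills_law (D : T -> T) a1 a2 a3 u v p q F :
  (forall x y, D (x + y) = D x + D y) ->
  (forall x y, D (x * y) = D x * y + x * D y) ->
  D a3 = 0 -> D u = p -> D v = - q ->
  2 * D p = - 2 * a1 * u + 4 * a2 * u ^+ 3 - 6 * a3 * u ^+ 5 ->
  2 * D q = - (- 2 * a1 * v + 4 * a2 * v ^+ 3 - 6 * a3 * v ^+ 5) ->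
  p ^+ 2 = qQ a1 a2 a3 (u ^+ 2) -> q ^+ 2 = qQ a1 a2 a3 (v ^+ 2) ->
  F ^+ 2 * ((u * q - v * p) ^+ 2 + a3 * u ^+ 2 * v ^+ 2 * (u ^+ 2 - v ^+ 2) ^+ 2)
    = (u ^+ 2 - v ^+ 2) ^+ 2 ->
  4 * (u ^+ 2 - v ^+ 2) * F
    * ((u * q - v * p) ^+ 2 + a3 * u ^+ 2 * v ^+ 2 * (u ^+ 2 - v ^+ 2) ^+ 2)
    * D F = 0.
Proof.
move=> DD DM Da3 Du Dv Dp Dq pE qE' FT.
have DN x : D (- x) = - D x by exact: additiveN.
have D2 x : D (x ^+ 2) = 2 * x * D x by rewrite expr2 DM; ring.
set N := u * q - v * p in FT *; set M := u ^+ 2 - v ^+ 2 in FT *.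
set t := N ^+ 2 + _ in FT *.
have DMv : D M = 2 * (u * p + v * q).
  by rewrite /M DD DN !D2 Du Dv; ring.
have DNv : 2 * D N = 4 * p * q + u * (2 * D q) - v * (2 * D p).
  by rewrite /N DD DN !DM Du Dv; ring.
have Dt : M * (2 * D t) = 4 * D M * t.
  have -> : 2 * D t = 2 * N * (2 * D N) - 4 * a3 * u * v * N * M ^+ 2
                      + 4 * a3 * u ^+ 2 * v ^+ 2 * M * D M.
    rewrite /t DD (D2 N) (DM _ (M ^+ 2)) (DM _ (v ^+ 2)) DM (D2 M) (D2 v) (D2 u).
    by rewrite Da3 Du Dv /N; ring.
  (* This is [D (N / M) = a3 u v M] cleared of denominators. As [D (u v) = - N], it makes
     [t / M ^ 2 = (N / M) ^ 2 + a3 u ^ 2 v ^ 2] constant for [D]. *)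
  have key : M * (2 * D N) - 2 * D M * N - 2 * a3 * u * v * M ^+ 3 = 0.
    rewrite DNv Dp Dq DMv /N.
    (* The products [p q] cancel, and the roots survive only through [q ^ 2 - p ^ 2], which the
       hypotheses express by [qQ]. *)
    have -> : forall X Y Z : T,
        M * X - 2 * Y * (u * q - v * p) - Z
        = M * (X - 4 * p * q) - 2 * (Y - 2 * (u * p + v * q)) * (u * q - v * p)
          - 4 * u * v * (q ^+ 2 - p ^+ 2) - Z.
      by move=> X Y Z; rewrite /M; ring.
    by rewrite pE qE' /qQ /M; ring.
  apply/eqP; rewrite -subr_eq0; apply/eqP.
  transitivity (2 * N * (M * (2 * D N) - 2 * D M * N - 2 * a3 * u * v * M ^+ 3)).
    by rewrite /t; ring.
  by rewrite key mulr0.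
have DFT : 2 * F * D F * t + F ^+ 2 * D t = 2 * M * D M.
  by rewrite -[RHS]D2 -FT DM D2.
transitivity (2 * M * (2 * F * D F * t + F ^+ 2 * D t) - F ^+ 2 * (M * (2 * D t))).
  by ring.
rewrite DFT Dt.
transitivity (4 * D M * (M ^+ 2 - F ^+ 2 * t)); first by ring.
by rewrite FT subrr mulr0.
Qed.

End Quartics.

Local Notation C := series_const.

Lemma sqrt_unique n (R : comPzRingType) (a b : {series R[n]}) :
  (exists h : R, h + h = 1) -> a 0%MM = 1 -> b 0%MM = 1 -> a ^+ 2 = b ^+ 2 -> a = b.
Proof.
move=> R2 a1 b1 ab; have f1 : (a ^+ 2) 0%MM = 1 by rewrite expr2 scoefM0 a1 mulr1.
have [_ _ su] := series_sqrtP R2 f1.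
by rewrite -(su a) // -(su b).
Qed.

(* Unlike the square roots and the quotients chosen in Bc_law, these equations
   are preserved by ring homomorphisms.  *)
Record Bc_data (R : comPzRingType) (a1 a2 a3 : R) (p : {series R[1]})
    (H s F : {series R[2]}) : Prop := BcData {
  Bc_p0 : p 0%MM = 1;
  Bc_pE : p ^+ 2 = Bc_Q a1 a2 a3;
  Bc_H0 : H 0%MM = 1;
  Bc_HE : H * (series_var 0 - series_var 1) =
    series_var 0 * (p \So [tuple series_var 1]) - series_var 1 * (p \So [tuple series_var 0]);
  Bc_s0 : s 0%MM = 1;
  Bc_sE : s ^+ 2 = H ^+ 2
    + C a3 * series_var 0 ^+ 2 * series_var 1 ^+ 2 * (series_var 0 + series_var 1) ^+ 2;
  Bc_FE : F * s = series_var 0 + series_var 1 }.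

Lemma Bc_law_data (R : comPzRingType) (a1 a2 a3 : R) :
  (exists h : R, h + h = 1) ->
  exists p H s, Bc_data a1 a2 a3 p H s (Bc_law a1 a2 a3).
Proof.
move=> R2; have [p0 pE _] := series_sqrtP R2 (Bc_Q0 a1 a2 a3).
have [H0 HE] := Bc_HP a1 a2 a3 R2; have [s0 sE FE] := Bc_lawP a1 a2 a3 R2.
exists (series_sqrt (Bc_Q a1 a2 a3)), (Bc_H a1 a2 a3).
by eexists; split; [exact: p0|exact: pE|exact: H0|exact: HE|exact: s0|exact: sE|exact: FE].
Qed.

Lemma Bc_data_map (R S : comPzRingType) (phi : {rmorphism R -> S}) a1 a2 a3 p H s F :
  Bc_data a1 a2 a3 p H s F ->
  Bc_data (phi a1) (phi a2) (phi a3) (series_map phi p) (series_map phi H)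
    (series_map phi s) (series_map phi F).
Proof.
move=> [p0 pE H0 HE s0 sE FE].
have mapsub (i : 'I_2) : series_map phi (p \So [tuple series_var i])
    = series_map phi p \So [tuple series_var i].
  by apply: series_map_subst; apply: ord1_ind; rewrite /= series_map_var.
have map0 n (f : {series R[n]}) : f 0%MM = 1 -> series_map phi f 0%MM = 1.
  by move=> f0; rewrite /= f0 rmorph1.
split; rewrite ?map0 // -?series_mapX ?pE ?sE.
- by rewrite /Bc_Q !series_mapE.
- have := congr1 (series_map phi) HE.
  by rewrite !series_mapE !mapsub.
- by rewrite !series_mapE.
- by rewrite -series_mapM FE series_mapE !series_map_var.
Qed.

(** * Square, symmetry, unit and inverse of the Buchstaber law *)

Section Law.
Variables (R : comPzRingType) (a1 a2 a3 : R) (p : {series R[1]}).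
Variables (H s F : {series R[2]}).
Hypothesis R2 : exists h : R, h + h = 1.
Hypothesis Bc : Bc_data a1 a2 a3 p H s F.

Local Notation u := (series_var 0 : {series R[2]}).
Local Notation v := (series_var 1 : {series R[2]}).
Local Notation P := (p \So [tuple u]).
Local Notation Q := (p \So [tuple v]).
Local Notation E := (qE (C a1) (C a2) (C a3) (u ^+ 2) (v ^+ 2)).
Local Notation D := (qC (C a1) (C a2) (C a3) (u ^+ 2) (v ^+ 2)).

Lemma law0 : F 0%MM = 0.
Proof.
have := congr1 (fun f : {series R[2]} => f 0%MM) (Bc_FE Bc).
by rewrite scoefM0 (Bc_s0 Bc) mulr1 scoefD !series_var0 addr0.
Qed.

Lemma root_subst k (a : {series R[k]}) : a 0%MM = 0 ->
  (p \So [tuple a]) ^+ 2 = qQ (C a1) (C a2) (C a3) (a ^+ 2).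
Proof.
move=> a0; have S := zero_const1 a0; rewrite -substX // (Bc_pE Bc) /Bc_Q.
rewrite !(substE S) subst1_var // /qQ; ring.
Qed.

Lemma root_sqr_u : P ^+ 2 = qQ (C a1) (C a2) (C a3) (u ^+ 2).
Proof. by apply: root_subst; rewrite series_var0. Qed.

Lemma root_sqr_v : Q ^+ 2 = qQ (C a1) (C a2) (C a3) (v ^+ 2).
Proof. by apply: root_subst; rewrite series_var0. Qed.

Lemma root_subst0 k (a : {series R[k]}) : a 0%MM = 0 -> (p \So [tuple a]) 0%MM = 1.
Proof. by move=> a0; rewrite scoef0_subst ?(Bc_p0 Bc) //; apply: zero_const1. Qed.

(** [Q] is even, so both sides are square roots of the same series with constant term 1. *)
Lemma root_even k (a : {series R[k]}) : a 0%MM = 0 ->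
  p \So [tuple - a] = p \So [tuple a].
Proof.
move=> a0; have Na0 : (- a) 0%MM = 0 by rewrite scoefN a0 oppr0.
by apply: (sqrt_unique R2); rewrite ?root_subst0 ?root_subst // sqrrN.
Qed.

Lemma law_norm : (u - v) ^+ 2 * s ^+ 2 = E - 2 * u * v * P * Q.
Proof.
rewrite -(qE_norm root_sqr_u root_sqr_v) -(Bc_HE Bc) (Bc_sE Bc); ring.
Qed.

Lemma sreg_uv_sub : sreg 1 (u - v).
Proof.
have -> : u - v = u + C (- 1) * v.
  by apply/seriesP => m; rewrite !scoefD scoefN scoefCM mulN1r.
exact: sreg_lin.
Qed.

Lemma sreg_uv_add : sreg 1 (u + v).
Proof.
have -> : u + v = u + C 1 * v by rewrite [C 1 * v]mul1r.
exact: sreg_lin.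
Qed.

Lemma sreg_nat k : (k = 2 \/ k = 4)%N -> sreg 0 (k%:R : {series R[2]}).
Proof.
have [h hh] := R2; have CR j : (j%:R : {series R[2]}) = C j%:R.
  apply/seriesP => m; rewrite scoefMn /=.
  by case: eqP; rewrite ?mul0rn.
case=> ->; rewrite CR.
  by apply: (@sreg_const _ _ _ h); rewrite mulr_natr mulr2n.
apply: (@sreg_const _ _ _ (h * h)); rewrite (natrM _ 2 2) mulrACA.
by rewrite mulr_natr mulr2n hh mulr1.
Qed.

(** By [law_norm] the series is [(u - v) ^ 2 s ^ 2] with [s] a unit. *)
Lemma sreg_law_norm : sreg (1 + 1 + (0 + 0)) (E - 2 * u * v * P * Q).
Proof.
rewrite -law_norm !expr2; have us := sreg_unit (Bc_s0 Bc).
by apply: sregM; apply: sregM => //; apply: sreg_uv_sub.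
Qed.

Lemma law_sqr_norm : F ^+ 2 * (E - 2 * u * v * P * Q) = (u ^+ 2 - v ^+ 2) ^+ 2.
Proof.
rewrite -law_norm mulrCA -exprMn (Bc_FE Bc); ring.
Qed.

(** After multiplication by the regular factor [E - w], both sides equal [D (u ^ 2 - v ^ 2) ^ 2]. *)
Lemma law_sqr : D * F ^+ 2 = E + 2 * u * v * P * Q.
Proof.
apply: (sreg_eq sreg_law_norm); rewrite (qE_conj root_sqr_u root_sqr_v) -law_sqr_norm; ring.
Qed.

(** Combines [law_sqr], multiplied by [F ^ 2], with [law_sqr_norm]. The parameters are later
    recovered from this equation. *)
Lemma law_quadratic : D * F ^+ 4 - 2 * E * F ^+ 2 + (u ^+ 2 - v ^+ 2) ^+ 2 = 0.
Proof.
have -> : D * F ^+ 4 = D * F ^+ 2 * F ^+ 2 by ring.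
by rewrite law_sqr -law_sqr_norm; ring.
Qed.

(** [F - (u + v) = F (1 - s)], and both factors have order at least 1. *)
Lemma law_lead : slow 2 (F - (u + v)).
Proof.
rewrite -(Bc_FE Bc) -[F in F - _]mulr1 -mulrBr; apply: (@slowM _ _ 1 1).
  exact/slow1E/law0.
exact/slow1/(Bc_s0 Bc).
Qed.

Lemma sreg_law : sreg 1 F.
Proof. exact: sreg_lead sreg_uv_add law_lead. Qed.

Lemma Bc_H_unique (H' : {series R[2]}) : H' * (u - v) = u * Q - v * P -> H' = H.
Proof.
by rewrite -(Bc_HE Bc) ![_ * (u - v)]mulrC => /(sreg_eq sreg_uv_sub).
Qed.

(** The swap changes the sign of both sides of the equation for [H], so [H] is symmetric; uniqueness
    of the square root gives [s], and cancelling the unit [s] gives [F]. *)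
Lemma law_comm : F \So [tuple v; u] = F.
Proof.
have S : zero_const [tuple v; u] by apply: zero_const2; rewrite series_var0.
have [u0 v0] : u 0%MM = 0 /\ v 0%MM = 0 by rewrite !series_var0.
have [U V] := subst2_var v0 u0.
have H' : H \So [tuple v; u] = H.
  apply: Bc_H_unique; have := congr1 (fun f => f \So [tuple v; u]) (Bc_HE Bc).
  rewrite !(substE S) !(subst1_comp _ _ S) // U V => e.
  by rewrite -[LHS]opprK -mulrN opprB e opprB.
have s' : s \So [tuple v; u] = s.
  apply: (sqrt_unique R2); rewrite ?scoef0_subst ?(Bc_s0 Bc) // (Bc_sE Bc) -substX //.
  by rewrite (Bc_sE Bc) !(substE S) H' U V; ring.
have := congr1 (fun f => f \So [tuple v; u]) (Bc_FE Bc).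
rewrite !(substE S) s' U V addrC -(Bc_FE Bc) ![_ * s]mulrC.
exact: (sreg_eq (sreg_unit (Bc_s0 Bc))).
Qed.

Lemma law_unitr : F \So [tuple u; 0] = u.
Proof.
have [u0 v0] : u 0%MM = 0 /\ v 0%MM = 0 by rewrite !series_var0.
have z0 : (0 : {series R[2]}) 0%MM = 0 by rewrite scoef0.
have S : zero_const [tuple u; 0] by apply: zero_const2.
have [U V] := subst2_var u0 z0.
have H' : H \So [tuple u; 0] = 1.
  apply: (sreg_eq (@sreg_var 2 R 0)); rewrite mulr1.
  have := congr1 (fun f => f \So [tuple u; 0]) (Bc_HE Bc).
  rewrite !(substE S) !(subst1_comp _ _ S) // U V subst1_0 (Bc_p0 Bc).
  by rewrite subr0 mulrC => ->; rewrite mul0r subr0 [u * C 1]mulr1.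
have s' : s \So [tuple u; 0] = 1.
  apply: (sqrt_unique R2); rewrite ?scoef0_subst ?(Bc_s0 Bc) // ?scoef1 ?eqxx // -substX //.
  by rewrite (Bc_sE Bc) !(substE S) H' U V; ring.
have := congr1 (fun f => f \So [tuple u; 0]) (Bc_FE Bc).
by rewrite !(substE S) s' U V addr0 mulr1.
Qed.

Lemma law_inverse : F \So [tuple series_var 0; - series_var 0] = (0 : {series R[1]}).
Proof.
pose t : {series R[1]} := series_var 0.
have t0 : t 0%MM = 0 by rewrite series_var0.
have t0' : (- t) 0%MM = 0 by rewrite scoefN t0 oppr0.
have S := zero_const2 t0 t0'; have [U V] := subst2_var t0 t0'.
have := congr1 (fun f => f \So [tuple t; - t]) (Bc_FE Bc).
rewrite !(substE S) U V subrr mulrC; apply: sreg_inj.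
by apply: sreg_unit; rewrite scoef0_subst ?(Bc_s0 Bc).
Qed.

End Law.

(** * The invariant differential and associativity *)

Lemma sderiv_root0 n (R : comPzRingType) (p : {series R[1]}) (i j : 'I_n) :
  i != j -> sderiv i (p \So [tuple series_var j]) = 0.
Proof.
by move=> ij; rewrite sderiv_subst1 ?series_var0 // sderiv_var (negbTE ij) mulr0.
Qed.

(** The operators [P i d_i] and [P j d_j] commute because [P k] involves only the variable [k]. A
    derivation [P i d_i - P j d_j] that kills [F] therefore kills [P i d_i F], and by the chain rule
    also [p (F)]. *)
Lemma invariant_root n (R : comPzRingType) (p : {series R[1]}) (F : {series R[n]})
    (i j : 'I_n) :
  let P k := p \So [tuple series_var k] in
  i != j -> F 0%MM = 0 -> P i * sderiv i F = P j * sderiv j F ->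
  let d := p \So [tuple F] - P i * sderiv i F in
  P j * sderiv j d = P i * sderiv i d.
Proof.
move=> P ij F0 inv d.
have di : sderiv i (P i * sderiv i F) = P j * sderiv i (sderiv j F).
  by rewrite inv sderivM (sderiv_root0 _ ij) mul0r add0r.
have dj : sderiv j (P i * sderiv i F) = P i * sderiv i (sderiv j F).
  have ji : j != i by rewrite eq_sym.
  by rewrite sderivM (sderiv_root0 _ ji) mul0r add0r sderivC.
have alg (T : comPzRingType) (P' Q' f g h x : T) : P' * f = Q' * g ->
    Q' * (h * g - P' * x) = P' * (h * f - Q' * x).
  by move=> e; rewrite !mulrBr !(mulrCA _ h) e (mulrCA Q').
rewrite /d !sderivB di dj !(sderiv_subst1 _ _ F0); exact: alg inv.
Qed.

Section Associativity.
Variables (R : comPzRingType) (a1 a2 a3 : R) (p : {series R[1]}).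
Variables (H s F : {series R[2]}).
Hypothesis R2 : exists h : R, h + h = 1.
Hypothesis tf : forall (x : R) k, x *+ k.+1 = 0 -> x = 0.
Hypothesis Bc : Bc_data a1 a2 a3 p H s F.

Local Notation u := (series_var 0 : {series R[2]}).
Local Notation v := (series_var 1 : {series R[2]}).
Local Notation P := (p \So [tuple u]).
Local Notation Q := (p \So [tuple v]).

Let u0 : u 0%MM = 0. Proof. by rewrite series_var0. Qed.
Let v0 : v 0%MM = 0. Proof. by rewrite series_var0. Qed.

Lemma sderiv_root (i : 'I_2) : let x : {series R[2]} := series_var i in
  2 * ((p \So [tuple x]) * sderiv i (p \So [tuple x])) =
  - 2 * C a1 * x + 4 * C a2 * x ^+ 3 - 6 * C a3 * x ^+ 5.
Proof.
move=> x; have x0 : x 0%MM = 0 by rewrite series_var0.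
have := congr1 (sderiv i) (root_subst Bc x0).
rewrite /qQ !(sderivD, sderivN, sderivM, sderivX, sderiv1, sderiv_const).
have -> : sderiv i x = 1 by rewrite sderiv_var eqxx.
move=> /= e.
transitivity (((p \So [tuple x]) ^+ 1 * sderiv i (p \So [tuple x])) *+ 2); first by ring.
by rewrite e; ring.
Qed.

Lemma law_invariant : P * sderiv 0 F = Q * sderiv 1 F.
Proof.
pose D (f : {series R[2]}) := P * sderiv 0 f - Q * sderiv 1 f.
apply/eqP; rewrite -subr_eq0; apply/eqP; rewrite -/(D F).
have DD f g : D (f + g) = D f + D g by rewrite /D !sderivD; ring.
have DM f g : D (f * g) = D f * g + f * D g by rewrite /D !sderivM; ring.
have := derivation_kills_law DD DM _ _ _ _ _ (root_sqr_u Bc) (root_sqr_v Bc).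
move=> /(_ F) key.
have {}key : 4 * (u ^+ 2 - v ^+ 2) * F * (qE (C a1) (C a2) (C a3) (u ^+ 2) (v ^+ 2)
    - 2 * u * v * P * Q) * D F = 0.
  rewrite -(qE_norm (root_sqr_u Bc) (root_sqr_v Bc)); apply: key.
  - by rewrite /D !sderiv_const; ring.
  - by rewrite /D !sderiv_var eqxx (_ : (1 == 0 :> 'I_2) = false) // mulr1n mulr0n; ring.
  - by rewrite /D !sderiv_var eqxx (_ : (0 == 1 :> 'I_2) = false) // mulr1n mulr0n; ring.
  - by rewrite /D (@sderiv_root0 _ _ _ 1 0) // -(sderiv_root 0); ring.
  - by rewrite /D (@sderiv_root0 _ _ _ 0 1) // -(sderiv_root 1); ring.
  by rewrite (qE_norm (root_sqr_u Bc) (root_sqr_v Bc)); apply: (law_sqr_norm Bc).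
(* The factors in front of [D F] are all regular: 4, [(u - v) (u + v)], [F] and [E - w]. *)
move: key; apply: sreg_inj.
apply: sregM (sreg_law_norm Bc); apply: sregM (sreg_law Bc).
apply: sregM; first by apply: (sreg_nat R2); right.
have -> : u ^+ 2 - v ^+ 2 = (u - v) * (u + v) by ring.
by apply: sregM; [apply: sreg_uv_sub|apply: sreg_uv_add].
Qed.

Lemma law_deriv_u0 : sderiv 0 F \So [tuple u; 0] = 1.
Proof.
have := congr1 (sderiv 0) (law_unitr R2 Bc).
by rewrite sderiv_subst2 ?scoef0 // sderiv0 mulr0 addr0 sderiv_var eqxx mulr1.
Qed.

Lemma subst_eval_v0 (f : {series R[2]}) (m : 'X_{1..2}) :
  f \So [tuple u; 0] = 0 -> m 1 = 0%N -> f m = 0.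
Proof.
move=> f0 m1; rewrite -(@subst_eval0 _ _ 1 [tuple u; 0]) ?f0 ?scoef0 //.
exact: ord2_ind.
Qed.

Lemma root_law : p \So [tuple F] = P * sderiv 0 F.
Proof.
apply/eqP; rewrite -subr_eq0; apply/eqP.
have F0 := law0 Bc; have z0 : (0 : {series R[2]}) 0%MM = 0 by rewrite scoef0.
have S := zero_const2 u0 z0; have [U V] := subst2_var u0 z0.
apply: (@transport_unique _ _ 1 0 Q P) => //; first exact: (root_subst0 Bc).
  exact: (invariant_root _ F0 law_invariant).
move=> m; apply: subst_eval_v0.
rewrite substB // substM // !(subst1_comp _ _ S) // U law_deriv_u0 (law_unitr R2 Bc).
by rewrite mulr1 subrr.
Qed.

Lemma law_unitl : F \So [tuple 0; v] = v.
Proof.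
have z0 : (0 : {series R[2]}) 0%MM = 0 by rewrite scoef0.
have [U V] := subst2_var z0 v0; have [U' V'] := subst2_var v0 z0.
rewrite -[in LHS](law_comm R2 Bc) subst2_comp ?U ?V //; last exact: zero_const2.
rewrite -[RHS]U' -[in RHS](law_unitr R2 Bc) subst2_comp ?U' ?subst0 //; exact: zero_const2.
Qed.

Lemma law_assoc :
  let x : {series R[3]} := series_var 0 in
  let y : {series R[3]} := series_var 1 in
  let z : {series R[3]} := series_var 2 in
  F \So [tuple F \So [tuple x; y]; z] = F \So [tuple x; F \So [tuple y; z]].
Proof.
move=> x y z.
have [x0 [y0 z0]] : x 0%MM = 0 /\ y 0%MM = 0 /\ z 0%MM = 0 by rewrite !series_var0.
have F0 := law0 Bc; have o0 : (0 : {series R[3]}) 0%MM = 0 by rewrite scoef0.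
have Fxy0 : (F \So [tuple x; y]) 0%MM = 0 by rewrite scoef0_subst //; apply: zero_const2.
have Fyz0 : (F \So [tuple y; z]) 0%MM = 0 by rewrite scoef0_subst //; apply: zero_const2.
have inv k (a b : {series R[k]}) : a 0%MM = 0 -> b 0%MM = 0 ->
    (p \So [tuple a]) * (sderiv 0 F \So [tuple a; b])
    = (p \So [tuple b]) * (sderiv 1 F \So [tuple a; b]).
  move=> a0 b0; have S := zero_const2 a0 b0; have [U V] := subst2_var a0 b0.
  have := congr1 (fun f => f \So [tuple a; b]) law_invariant.
  by rewrite !substM // !(subst1_comp _ _ S) // U V.
have root k (a b : {series R[k]}) : a 0%MM = 0 -> b 0%MM = 0 ->
    p \So [tuple F \So [tuple a; b]]
    = (p \So [tuple a]) * (sderiv 0 F \So [tuple a; b]).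
  move=> a0 b0; have S := zero_const2 a0 b0; have [U V] := subst2_var a0 b0.
  have := congr1 (fun f => f \So [tuple a; b]) root_law.
  by rewrite substM // !(subst1_comp _ _ S) // U.
have dx (i : 'I_3) : (sderiv i x = (i == 0)%:R) * (sderiv i y = (i == 1)%:R)
    * (sderiv i z = (i == 2)%:R) by rewrite !sderiv_var.
have d10 : (1 == 0 :> 'I_3) = false by [].
have d01 : (0 == 1 :> 'I_3) = false by [].
have d12 : (1 == 2 :> 'I_3) = false by [].
have d02 : (0 == 2 :> 'I_3) = false by [].
apply/eqP; rewrite -subr_eq0; apply/eqP.
apply: (@transport_unique _ _ 1 0 (p \So [tuple y]) (p \So [tuple x])) => //.
- exact: (root_subst0 Bc).
- rewrite !sderivB !(sderiv_subst2 _ _ Fxy0 z0) !(sderiv_subst2 _ _ x0 Fyz0).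
  rewrite !(sderiv_subst2 _ _ x0 y0) !(sderiv_subst2 _ _ y0 z0) !dx.
  rewrite ?eqxx ?d10 ?d01 ?d12 ?d02 !mulr1n !mulr0n ?(mulr0, mulr1, addr0, add0r).
  (* On the left, the outer derivative factors out and [inv] applies at [(x, y)]. On the right,
     [root] at [(y, z)] produces the root at [F (y, z)], and [inv] applies at [(x, F (y, z))]. *)
  rewrite !mulrBr; congr (_ - _).
    by rewrite mulrCA -(inv _ _ _ x0 y0) mulrCA.
  by rewrite mulrCA -(root _ _ _ y0 z0) mulrC -(inv _ _ _ x0 Fyz0).
(* Initial condition of the transport equation: at [y = 0] both bracketings reduce to [F (x, z)]. *)
have z' : (tnth [tuple x; 0; z] : 'I_3 -> {series R[3]}) =1
    (fun j => if j == 1 then 0 else series_var j) by apply: ord3_ind.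
move=> m m1; rewrite -(subst_eval0 _ z' m1).
have S := zero_const3 x0 o0 z0; have [[X Y] Z] := subst3_var x0 o0 z0.
rewrite substB !(subst2_comp _ _ _ S) // X Y Z.
have -> : F \So [tuple x; 0] = x.
  have := congr1 (fun f => f \So [tuple x; 0]) (law_unitr R2 Bc).
  have S' := zero_const2 x0 o0; have [U V] := subst2_var x0 o0.
  by rewrite (subst2_comp _ u0 _ S') ?scoef0 // U subst0.
have -> : F \So [tuple 0; z] = z.
  have := congr1 (fun f => f \So [tuple 0; z]) law_unitl.
  have S' := zero_const2 o0 z0; have [U V] := subst2_var o0 z0.
  by rewrite (subst2_comp _ _ v0 S') ?scoef0 // V subst0.
by rewrite subrr scoef0.
Qed.

Lemma law_fgl : is_comm_fgl F.
Proof.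
split; [exact: law_unitr R2 Bc|exact: law_unitl|exact: law_assoc|].
exact: law_comm R2 Bc.
Qed.

End Associativity.

(** * Universality *)

Section FormalGroupLaws.
Variables (R : comPzRingType) (F : {series R[2]}).
Hypothesis fgl : is_comm_fgl F.
Hypothesis inv : is_formal_inverse F (- series_var 0).

Local Notation u := (series_var 0 : {series R[2]}).
Local Notation v := (series_var 1 : {series R[2]}).

Lemma fgl0 : F 0%MM = 0.
Proof.
have [unitr _ _ _] := fgl.
rewrite -(series_var0 R (0 : 'I_2)) -unitr scoef0_subst //.
by apply: zero_const2; rewrite ?series_var0 ?scoef0.
Qed.

Section Points.
Variable k : nat.
Implicit Types a b c : {series R[k]}.
Let z0 : (0 : {series R[k]}) 0%MM = 0. Proof. by rewrite scoef0. Qed.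
Let zu : (0 : {series R[2]}) 0%MM = 0. Proof. by rewrite scoef0. Qed.

Lemma fgl_unitr a : a 0%MM = 0 -> F \So [tuple a; 0] = a.
Proof.
move=> a0; have [unitr _ _ _] := fgl; have S := zero_const2 a0 z0.
have [U _] := subst2_var a0 z0.
have := congr1 (fun f => f \So [tuple a; 0]) unitr.
by rewrite (subst2_comp _ (series_var0 _ _) zu S) U subst0.
Qed.

Lemma fgl_comm a b : a 0%MM = 0 -> b 0%MM = 0 ->
  F \So [tuple b; a] = F \So [tuple a; b].
Proof.
move=> a0 b0; have [_ _ _ comm] := fgl; have S := zero_const2 a0 b0.
have [U V] := subst2_var a0 b0.
have := congr1 (fun f => f \So [tuple a; b]) comm.
by rewrite (subst2_comp _ (series_var0 _ _) (series_var0 _ _) S) U V.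
Qed.

Lemma fgl_assoc a b c : a 0%MM = 0 -> b 0%MM = 0 -> c 0%MM = 0 ->
  F \So [tuple F \So [tuple a; b]; c] = F \So [tuple a; F \So [tuple b; c]].
Proof.
move=> a0 b0 c0; have [_ _ assoc _] := fgl; have S := zero_const3 a0 b0 c0.
have [[X Y] Z] := subst3_var a0 b0 c0.
have x0 (i : 'I_3) : (series_var i : {series R[3]}) 0%MM = 0 by rewrite series_var0.
have F0 (i j : 'I_3) : (F \So [tuple series_var i; series_var j : {series R[3]}]) 0%MM = 0.
  by rewrite scoef0_subst ?fgl0 //; apply: zero_const2.
have := congr1 (fun f => f \So [tuple a; b; c]) assoc.
rewrite (subst2_comp _ (F0 0 1) (x0 2) S) (subst2_comp _ (x0 0) (F0 1 2) S).
by rewrite !(subst2_comp _ (x0 _) (x0 _) S) X Y Z.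
Qed.

Lemma fgl_inverse a : a 0%MM = 0 -> F \So [tuple a; - a] = 0.
Proof.
move=> a0; have S := zero_const1 a0; have [t0' tt'] := inv.
have := congr1 (fun f => f \So [tuple a]) tt'.
by rewrite (subst2_comp _ (series_var0 _ _) t0' S) substN subst1_var // subst0.
Qed.

(** Both [F (- a, - b)] and [- F (a, b)] are inverses of [F (a, b)], and inverses in a group are
    unique. *)
Lemma fgl_odd a b : a 0%MM = 0 -> b 0%MM = 0 ->
  F \So [tuple - a; - b] = - (F \So [tuple a; b]).
Proof.
move=> a0 b0.
have N0 (c : {series R[k]}) : c 0%MM = 0 -> (- c) 0%MM = 0 by move=> c0; rewrite scoefN c0 oppr0.
have F0 (c d : {series R[k]}) : c 0%MM = 0 -> d 0%MM = 0 -> (F \So [tuple c; d]) 0%MM = 0.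
  by move=> c0 d0; rewrite scoef0_subst ?fgl0 //; apply: zero_const2.
have [Na0 Nb0] := (N0 _ a0, N0 _ b0).
set G := F \So [tuple a; b]; set G' := F \So [tuple - a; - b].
have G0 : G 0%MM = 0 by apply: F0.
have G'0 : G' 0%MM = 0 by apply: F0.
have GG' : F \So [tuple G; G'] = 0.
  rewrite /G /G' (fgl_comm Nb0 Na0) (fgl_assoc a0 b0 (F0 _ _ Nb0 Na0)).
  rewrite -(fgl_assoc b0 Nb0 Na0) (fgl_inverse b0) (fgl_comm Na0 z0).
  by rewrite (fgl_unitr Na0) fgl_inverse.
have NGG : F \So [tuple - G; G] = 0 by rewrite (fgl_comm G0 (N0 _ G0)) fgl_inverse.
rewrite -(fgl_unitr G'0) (fgl_comm z0 G'0) -NGG (fgl_assoc (N0 _ G0) G0 G'0).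
by rewrite GG' fgl_unitr //; apply: N0.
Qed.

End Points.

Lemma fgl_lead : slow 2 (F - (u + v)).
Proof.
have [unitr unitl _ _] := fgl.
move=> m; rewrite mdegE !big_ord_recl big_ord0 addn0 => m2.
have e0 : (ord0 : 'I_2) = 0 by [].
have e1 : lift ord0 (ord0 : 'I_1) = 1 :> 'I_2 by apply: val_inj.
rewrite e0 e1 in m2.
have E0 : u m = (m == U_(0%R))%MM%:R by rewrite /=; case: eqP.
have E1 : v m = (m == U_(1%R))%MM%:R by rewrite /=; case: eqP.
(* A monomial of degree below 2 lacks [v] or [u], so one of the two unit axioms gives its
   coefficient in [F]. *)
rewrite scoefD scoefN scoefD; case: (posnP (m 1)) => m1.
  rewrite -(@subst_eval0 _ _ 1 [tuple u; 0] F) //; last exact: ord2_ind.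
  rewrite unitr E1; case: eqP => [mE|_]; last by rewrite addr0 subrr.
  by move: m1; rewrite mE mnm1E eqxx.
have m0 : m 0 = 0%N by case: (m 0) (m 1) m2 m1 => [|?] [|?] //=; rewrite addnS.
rewrite -(@subst_eval0 _ _ 0 [tuple 0; v] F) //; last exact: ord2_ind.
rewrite unitl E0; case: eqP => [mE|_]; last by rewrite add0r subrr.
by move: m0; rewrite mE mnm1E eqxx.
Qed.

End FormalGroupLaws.

Lemma subst_id n (R : comPzRingType) (f : {series R[n]}) (g : n.-tuple {series R[n]}) :
  (forall i, tnth g i = series_var i) -> f \So g = f.
Proof.
move=> gE; have g0 : zero_const g by move=> i; rewrite gE series_var0.
move: f; apply: (@scont_eq _ _ _ 0 _ id); [exact: scont_subst|exact: scont_id|].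
move=> c p; rewrite substZ subst_smon // smon_prod; congr (_ * _).
by apply: eq_bigr => i _; rewrite gE.
Qed.

(** * The quadratic equation for [F ^ 2] and its consequences *)

Section Quadratic.
Variable R : comPzRingType.

Local Notation u := (series_var 0 : {series R[2]}).
Local Notation v := (series_var 1 : {series R[2]}).
Local Notation U := (u ^+ 2).
Local Notation V := (v ^+ 2).
Local Notation E a1 a2 a3 := (qE (C a1) (C a2) (C a3) U V).
Local Notation D a1 a2 a3 := (qC (C a1) (C a2) (C a3) U V).

Let u0 : u 0%MM = 0. Proof. by rewrite series_var0. Qed.
Let v0 : v 0%MM = 0. Proof. by rewrite series_var0. Qed.
Let Nu0 : (- u) 0%MM = 0. Proof. by rewrite scoefN u0 oppr0. Qed.
Let Nv0 : (- v) 0%MM = 0. Proof. by rewrite scoefN v0 oppr0. Qed.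

Lemma subst_uv (f : {series R[2]}) : f \So [tuple u; v] = f.
Proof. by apply: subst_id; apply: ord2_ind. Qed.

Lemma bar_var (x : {series R[2]}) : x 0%MM = 0 -> (- series_var 0) \So [tuple x] = - x.
Proof. by move=> x0; rewrite substN subst1_var. Qed.

(** Substitute [x = - U], [y = - V] and [z = z1 = - F ^ 2], using [fgl_odd], in the identity that
    defines the two-valued law. Its left side is [(z - z1) (z - z2) = 0], and the inverse of the
    leading coefficient cancels. *)
Lemma modulus_square_quadratic a1 a2 a3 (F : {series R[2]}) :
  is_comm_fgl F -> is_formal_inverse F (- series_var 0) ->
  modulus_square_is_Bc F (- series_var 0) a1 a2 a3 ->
  D a1 a2 a3 * F ^+ 4 - 2 * E a1 a2 a3 * F ^+ 2 + (U - V) ^+ 2 = 0.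
Proof.
move=> fgl inv [T1 [T2 [[T1E T2E] tv]]].
have F0 := fgl0 fgl.
have z1E : (F \So [tuple u; v]) * (F \So [tuple - u; - v]) = - F ^+ 2.
  by rewrite (fgl_odd fgl inv u0 v0) subst_uv mulrN.
move: T1E T2E; rewrite !bar_var // z1E.
move: ((F \So _) * _) => z2 T1E T2E.
have x0 : (u * - u) 0%MM = 0 by rewrite scoefM0 u0 mul0r.
have y0 : (v * - v) 0%MM = 0 by rewrite scoefM0 v0 mul0r.
have zz0 : (- F ^+ 2) 0%MM = 0 by rewrite scoefN expr2 scoefM0 F0 mul0r oppr0.
have S := zero_const3 x0 y0 zz0; have [[X Y] Z] := subst3_var x0 y0 zz0.
have S2 := zero_const2 x0 y0.
have i0 (i : 'I_3) : (series_var i : {series R[3]}) 0%MM = 0 by rewrite series_var0.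
have L (f : {series R[2]}) : (f \So [tuple series_var 0; series_var 1])
    \So [tuple u * - u; v * - v; - F ^+ 2] = f \So [tuple u * - u; v * - v].
  by rewrite (subst2_comp _ (i0 0) (i0 1) S) X Y.
have BsE : Bc_series a1 a2 a3 \So [tuple u * - u; v * - v; - F ^+ 2]
    = Bc_family (C a1) (C a2) (C a3) (- F ^+ 2) (- U) (- V).
  rewrite /Bc_series /Bc_family !(substE S) X Y Z.
  by move: (C a1) (C a2) (C a3) => c1 c2 c3; ring.
move: BsE tv; rewrite /is_Bc_two_valued; move: (Bc_series a1 a2 a3) => B BsE tv.
have := congr1 (fun f => f \So [tuple u * - u; v * - v; - F ^+ 2]) tv.
rewrite !(substD, substN, substM S, substX S) !L Z T1E T2E.
rewrite BsE Bc_familyE => e.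
have LI : (Bc_lead a1 a2 a3 \So [tuple u * - u; v * - v])
    * (exact_quot 1 (Bc_lead a1 a2 a3) \So [tuple u * - u; v * - v]) = 1.
  by rewrite -(substM S2) mulrC Bc_lead_inv subst1.
have lhs0 (a b : {series R[2]}) : (- a) ^+ 2 - (- a + b) * - a + - a * b = 0 by ring.
rewrite lhs0 in e; move/(congr1 ( *%R (Bc_lead a1 a2 a3 \So [tuple u * - u; v * - v]))): e.
rewrite mulr0 mulrA LI mul1r => e.
by rewrite [RHS]e; move: (qC _ _ _ _ _) (qE _ _ _ _ _) => d e'; ring.
Qed.

Lemma slow_var i : slow 1 (series_var i : {series R[2]}).
Proof. by apply/slow1E; rewrite series_var0. Qed.

Lemma qC_lead c1 c2 c3 : slow 1 (qC c1 c2 c3 U V - 1).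
Proof.
have -> : qC c1 c2 c3 U V - 1 = u * (u * V * (- 2 * c2 + c2 ^+ 2 * U * V
    + 4 * c3 * (U + V - c1 * U * V))) by rewrite /qC; ring.
by apply/slow1E; rewrite scoefM0 u0 mul0r.
Qed.

Lemma qE_lead c1 c2 c3 : slow 3 (qE c1 c2 c3 U V - (U + V)).
Proof.
have -> : qE c1 c2 c3 U V - (U + V) = v * (- 2 * c1 + c2 * (U + V) - 2 * c3 * U * V)
    * (u * u * v) by rewrite /qE; ring.
by apply: slowMl; apply: (@slowM _ _ 2 1); [apply: (@slowM _ _ 1 1)|]; apply: slow_var.
Qed.

Lemma quadratic_unique a1 a2 a3 p H s (F F' : {series R[2]}) :
  (exists h : R, h + h = 1) -> slow 2 (F - (u + v)) ->
  D a1 a2 a3 * F ^+ 4 - 2 * E a1 a2 a3 * F ^+ 2 + (U - V) ^+ 2 = 0 ->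
  Bc_data a1 a2 a3 p H s F' -> F = F'.
Proof.
move=> R2 Fl Fq Bc.
have Flead : slow 3 (F ^+ 2 - (u + v) ^+ 2).
  have -> : F ^+ 2 - (u + v) ^+ 2 = (F - (u + v)) * ((F - (u + v)) + 2 * (u + v)) by ring.
  apply: (@slowM _ _ 2 1) => //; apply: slowD; first exact: slowW Fl.
  by apply: slowMl; apply: slowD; apply: slow_var.
have F2 : slow 2 (F ^+ 2).
  rewrite -(subrK ((u + v) ^+ 2) (F ^+ 2)); apply: slowD; first exact: slowW Flead.
  by rewrite expr2; apply: (@slowM _ _ 1 1); apply: slowD; apply: slow_var.
have Dl := qC_lead (C a1) (C a2) (C a3); have El := qE_lead (C a1) (C a2) (C a3).
have conj := qE_conj (root_sqr_u Bc) (root_sqr_v Bc); have sqr := law_sqr Bc.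
have D0 : D a1 a2 a3 0%MM = 1.
  have := Dl 0%MM; rewrite mdeg0 scoefD scoefN => /(_ isT)/eqP.
  by rewrite subr_eq0 scoef1 eqxx => /eqP.
have P0 : (p \So [tuple u]) 0%MM = 1 by apply: (root_subst0 Bc).
have Q0 : (p \So [tuple v]) 0%MM = 1 by apply: (root_subst0 Bc).
move: (p \So [tuple u]) (p \So [tuple v]) P0 Q0 conj sqr => P Q P0 Q0.
move: (D a1 a2 a3) (E a1 a2 a3) Dl El D0 Fq => d e Dl El D0 Fq /= conj sqr.
have PQl : slow 1 (P * Q - 1).
  by apply/slow1E; rewrite scoefD scoefN scoefM0 P0 Q0 mulr1 scoef1 eqxx subrr.
(* The lowest form is [(u + v) ^ 2 - (u ^ 2 + v ^ 2) + 2 u v = 4 u v]. *)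
have reg : sreg (0 + (1 + 1)) (d * F ^+ 2 - e + 2 * u * v * P * Q).
  apply: (@sreg_lead _ _ _ _ (4%:R * (u * v))).
    apply: sregM; first by apply: (sreg_nat R2); right.
    by apply: sregM; apply: sreg_var.
  have -> : d * F ^+ 2 - e + 2 * u * v * P * Q - 4%:R * (u * v)
      = (d - 1) * F ^+ 2 + (F ^+ 2 - (u + v) ^+ 2) - (e - (U + V))
        + 2 * (u * v * (P * Q - 1)) by ring.
  apply: slowD; last first.
    apply: slowMl; apply: (@slowM _ _ 2 1) => //.
    by apply: (@slowM _ _ 1 1); apply: slow_var.
  apply: slowD; last exact: slowN.
  by apply: slowD => //; apply: (@slowM _ _ 1 2).
(* By [conj], [d] times the quadratic factors as [(d F ^ 2 - e - w) (d F ^ 2 - e + w)]. The second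
   factor is cancelled by [reg], and [sqr] identifies [e + w] with [d F' ^ 2]. *)
have dF : d * F ^+ 2 = d * F' ^+ 2.
  apply/eqP; rewrite sqr -subr_eq0; apply/eqP.
  apply: (sreg_inj reg).
  transitivity (d * (d * F ^+ 4 - 2 * e * F ^+ 2 + (U - V) ^+ 2)
     + ((e - 2 * u * v * P * Q) * (e + 2 * u * v * P * Q) - d * (U - V) ^+ 2)).
    by ring.
  by rewrite Fq conj subrr mulr0 addr0.
have {dF}FF : F ^+ 2 = F' ^+ 2 by apply: sreg_eq dF; apply: sreg_unit.
have reg2 : sreg (0 + 1) (F + F').
  apply: (@sreg_lead _ _ _ _ (2%:R * (u + v))).
    by apply: sregM; [apply: (sreg_nat R2); left|apply: sreg_uv_add].
  have -> : F + F' - 2%:R * (u + v) = (F - (u + v)) + (F' - (u + v)) by ring.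
  by apply: slowD => //; apply: (law_lead Bc).
apply/eqP; rewrite -subr_eq0; apply/eqP; apply: (sreg_inj reg2).
by rewrite mulrC -subr_sqr FF subrr.
Qed.

(** The law satisfies the quadratic equation for both parameter triples. The difference of the two
    equations, divided by [U V F ^ 2] and restricted to [v = 0], separates the three parameters. *)
Lemma Bc_data_params_unique a1 a2 a3 b1 b2 b3 p H s p' H' s' (F : {series R[2]}) :
  (exists h : R, h + h = 1) ->
  Bc_data a1 a2 a3 p H s F -> Bc_data b1 b2 b3 p' H' s' F ->
  [/\ a1 = b1, a2 = b2 & a3 = b3].
Proof.
move=> R2 Bc Bc'.
have q := law_quadratic Bc; have q' := law_quadratic Bc'.
have U1 := law_unitr R2 Bc.
have z0 : (0 : {series R[2]}) 0%MM = 0 by rewrite scoef0.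
have S := zero_const2 u0 z0; have [X Y] := subst2_var u0 z0.
(* [c] and [e] are the differences of the two [qC] and of the two [qE], divided by [U V]. *)
pose c := - 2 * (C a2 - C b2) + (C a2 ^+ 2 - C b2 ^+ 2) * U * V
  + 4 * C a3 * (U + V - C a1 * U * V) - 4 * C b3 * (U + V - C b1 * U * V).
pose e := - 2 * (C a1 - C b1) + (C a2 - C b2) * (U + V) - 2 * (C a3 - C b3) * U * V.
have ce : c * F ^+ 2 = 2 * e.
  apply: (@sreg_eq _ _ (1 + 1 + (1 + 1) + (1 + 1)) (U * V * F ^+ 2)).
    rewrite !expr2; apply: sregM; last by apply: sregM; apply: sreg_law Bc.
    by apply: sregM; apply: sregM; apply: sreg_var.
  apply/eqP; rewrite -subr_eq0; apply/eqP.
  transitivity ((D a1 a2 a3 * F ^+ 4 - 2 * E a1 a2 a3 * F ^+ 2 + (U - V) ^+ 2)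
    - (D b1 b2 b3 * F ^+ 4 - 2 * E b1 b2 b3 * F ^+ 2 + (U - V) ^+ 2)).
    by rewrite /qC /qE /c /e; ring.
  by apply: etrans (subrr 0); congr (_ - _); [exact: q|exact: q'].
pose d1 : R := a1 - b1; pose d2 : R := b2 - a2; pose d3 : R := a3 - b3.
have CB (x y : R) : C (x - y) = C x - C y :> {series R[2]}.
  by apply/seriesP => m; rewrite scoefD scoefN /=; case: ifP; rewrite ?subr0.
(* At [v = 0], where [F = u], the relation [ce] reads [4 (d1 + d2 u ^ 2 + d3 u ^ 4) = 0]; this fixes
   the reversed sign in [d2]. *)
have key : C d1 + u * u * (C d2 + u * u * C d3) = 0.
  apply: (sreg_inj (sreg_nat R2 (or_intror erefl))).
  have := congr1 (fun f => f \So [tuple u; 0]) ce.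
  rewrite /c /e !(substE S) U1 X Y !CB => e0.
  apply/eqP; rewrite -subr_eq0; apply/eqP.
  rewrite -[RHS](subrr (2 * (- 2 * (C a1 - C b1) + (C a2 - C b2) * (U + 0 ^+ 2)
     - 2 * (C a3 - C b3) * U * 0 ^+ 2))).
  by rewrite -{1}e0; ring.
have C0 (x : R) (f : {series R[2]}) : C x + u * u * f = 0 -> x = 0 /\ f = 0.
  move=> xf; have := congr1 (fun f : {series R[2]} => f 0%MM) xf.
  rewrite scoefD -mulrA scoefM0 u0 mul0r addr0 scoef0 /= eqxx => x0; split=> //.
  apply: (@sreg_inj _ _ _ (u * u)); first by apply: sregM; apply: sreg_var.
  by move: xf; rewrite x0 add0r.
have [d10 key2] := C0 _ _ key.
have [d20 d30] := C0 _ _ key2.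
have {}d30 : d3 = 0 by have := congr1 (fun f : {series R[2]} => f 0%MM) d30; rewrite scoef0 /= eqxx.
by split; apply/eqP; rewrite -subr_eq0 -/d1 -/d3 ?d10 ?d30 // -opprB -/d2 d20 oppr0.
Qed.


End Quadratic.

(** * The modulus square of the Buchstaber law *)

Section Modulus.
Variable R : comPzRingType.

Local Notation u := (series_var 0 : {series R[2]}).
Local Notation v := (series_var 1 : {series R[2]}).

Let u0 : u 0%MM = 0. Proof. by rewrite series_var0. Qed.
Let v0 : v 0%MM = 0. Proof. by rewrite series_var0. Qed.

Definition Bc_coef2 (T : comPzRingType) (a1 a2 a3 x y : T) : T :=
  (1 - a2 * x * y) ^+ 2 - 4 * a3 * x * y * (x + y + a1 * x * y).

Definition Bc_coef1 (T : comPzRingType) (a1 a2 a3 x y : T) : T :=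
  2 * (x + y) * (1 - a2 * x * y) - 4 * (x + y + a1 * x * y) - 4 * a3 * (x * y) ^+ 2.

(** The powers [z ^+ 1] and [z ^+ 0] stay visible so that [scoefz_subst] treats all three terms
    alike. *)
Lemma Bc_family_coef (T : comPzRingType) (a1 a2 a3 z x y : T) :
  Bc_family a1 a2 a3 z x y = Bc_coef2 a1 a2 a3 x y * z ^+ 2
    + Bc_coef1 a1 a2 a3 x y * z ^+ 1 + (x - y) ^+ 2 * z ^+ 0.
Proof. by rewrite /Bc_family /Bc_coef2 /Bc_coef1; ring. Qed.

Lemma Bc_coef2N (T : comPzRingType) (a1 a2 a3 x y : T) :
  Bc_coef2 a1 a2 a3 (- x) (- y) = qC a1 a2 a3 x y.
Proof. by rewrite /Bc_coef2 /qC; ring. Qed.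

Lemma Bc_coef1N (T : comPzRingType) (a1 a2 a3 x y : T) :
  Bc_coef1 a1 a2 a3 (- x) (- y) = 2 * qE a1 a2 a3 x y.
Proof. by rewrite /Bc_coef1 /qE; ring. Qed.

Section Subst.
Variables (k : nat) (x y : {series R[k]}).
Hypotheses (x0 : x 0%MM = 0) (y0 : y 0%MM = 0).

Lemma subst_coef2 a1 a2 a3 :
  Bc_coef2 (C a1) (C a2) (C a3) u v \So [tuple x; y]
  = Bc_coef2 (C a1) (C a2) (C a3) x y.
Proof.
have S := zero_const2 x0 y0; have [X Y] := subst2_var x0 y0.
by rewrite /Bc_coef2 !(substE S) X Y.
Qed.

Lemma subst_coef1 a1 a2 a3 :
  Bc_coef1 (C a1) (C a2) (C a3) u v \So [tuple x; y]
  = Bc_coef1 (C a1) (C a2) (C a3) x y.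
Proof.
have S := zero_const2 x0 y0; have [X Y] := subst2_var x0 y0.
by rewrite /Bc_coef1 !(substE S) X Y.
Qed.

Lemma subst_coef0 : (u - v) ^+ 2 \So [tuple x; y] = (x - y) ^+ 2.
Proof.
have S := zero_const2 x0 y0; have [X Y] := subst2_var x0 y0.
by rewrite !(substE S) X Y.
Qed.

End Subst.

Definition mlift (m : 'X_{1..2}) (j : nat) : 'X_{1..3} := [multinom [tuple m 0; m 1; j]].

(** Coefficient of [z ^ j] when a series in [x, y, z] is read as a series in [z] over [R[[x, y]]];
    [Bc_lead] is the case [j = 2]. *)
Definition scoefz (j : nat) (f : {series R[3]}) : {series R[2]} :=
  Series (fun m => f (mlift m j)).

Lemma mliftE m j : (mlift m j 0 = m 0) * (mlift m j 1 = m 1) * (mlift m j 2 = j).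
Proof. by rewrite !multinomE !(tnth_nth 0%N). Qed.

Lemma scoefz_subst (f : {series R[2]}) j k :
  scoefz j ((f \So [tuple series_var 0; series_var 1]) * series_var 2 ^+ k)
  = if j == k then f else 0.
Proof.
have x0 (i : 'I_3) : (series_var i : {series R[3]}) 0%MM = 0 by rewrite series_var0.
have S := zero_const2 (x0 0) (x0 1).
have md m i : mdeg (mlift m i) = (mdeg m + i)%N.
  rewrite !mdegE !big_ord_recl !big_ord0 !addn0 addnA.
  have -> : (ord0 : 'I_3) = 0 by [].
  have -> : lift ord0 (ord0 : 'I_2) = 1 :> 'I_3 by apply: val_inj.
  have -> : lift ord0 (lift ord0 (ord0 : 'I_1)) = 2 :> 'I_3 by apply: val_inj.
  rewrite !mliftE.
  have -> : (ord0 : 'I_2) = 0 by [].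
  by have -> : lift ord0 (ord0 : 'I_1) = 1 :> 'I_2 by apply: val_inj.
have cz : scont j (scoefz j).
  split=> [a b|d a ad m mlt]; first exact/seriesP.
  by rewrite /= ad // md ltn_add2r.
move: f; apply: (@scont_eq _ _ _ j).
- rewrite -[j in scont j]addn0.
  exact: (scont_comp (scontMr (series_var 2 ^+ k) (scont_subst _)) cz).
- split=> [a b|d a ad]; first by case: ifP; rewrite ?addr0.
  case: ifP => _; last by move=> m _; rewrite scoef0.
  by apply: slowW ad; rewrite leq_addr.
move=> c p; rewrite substZ subst_smon // /spow !big_ord_recl big_ord0 mulr1.
have -> : (ord0 : 'I_2) = 0 by [].
have -> : lift ord0 (ord0 : 'I_1) = 1 :> 'I_2 by apply: val_inj.
have mon : series_var 0 ^+ p 0 * series_var 1 ^+ p 1 * series_var 2 ^+ k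
    = smon (mlift p k) :> {series R[3]}.
  rewrite smon_prod !big_ord_recl big_ord0 mulr1 mulrA.
  have -> : (ord0 : 'I_3) = 0 by [].
  have -> : lift ord0 (ord0 : 'I_2) = 1 :> 'I_3 by apply: val_inj.
  have -> : lift ord0 (lift ord0 (ord0 : 'I_1)) = 2 :> 'I_3 by apply: val_inj.
  by rewrite !mliftE.
rewrite -mulrA [X in _ * X]mon; apply/seriesP => m.
rewrite -[LHS]/((C c * smon (mlift p k)) (mlift m j)) scoefCM.
have lift_eq : (mlift m j == mlift p k) = (m == p) && (j == k).
  apply/eqP/andP => [e|[/eqP-> /eqP->]] //.
  have [e0 e1 e2] : [/\ m 0 = p 0, m 1 = p 1 & j = k].
    by split; [rewrite -(mliftE m j) e|rewrite -(mliftE m j) e|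
      rewrite -(mliftE m j).2 e]; rewrite mliftE.
  split; last exact/eqP.
  by apply/eqP/mnmP; apply: ord2_ind.
rewrite [smon _ _]/= lift_eq; case: (j == k); last by rewrite andbF scoef0 mulr0.
by rewrite andbT scoefCM.
Qed.

Lemma Bc_leadE a1 a2 a3 :
  Bc_lead a1 a2 a3 = Bc_coef2 (C a1) (C a2) (C a3) u v.
Proof.
rewrite -[LHS]/(scoefz 2 (Bc_series a1 a2 a3)) /Bc_series Bc_family_coef.
have x0 (i : 'I_3) : (series_var i : {series R[3]}) 0%MM = 0 by rewrite series_var0.
have zD a b : scoefz 2 (a + b) = scoefz 2 a + scoefz 2 b by exact/seriesP.
rewrite !zD -(subst_coef2 (x0 0) (x0 1)) -(subst_coef1 (x0 0) (x0 1)).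
by rewrite -(subst_coef0 (x0 0) (x0 1)) !scoefz_subst /= !addr0.
Qed.

Lemma law_modulus_square a1 a2 a3 p H s (F : {series R[2]}) :
  (exists h : R, h + h = 1) -> is_comm_fgl F ->
  is_formal_inverse F (- series_var 0) -> Bc_data a1 a2 a3 p H s F ->
  modulus_square_is_Bc F (- series_var 0) a1 a2 a3.
Proof.
move=> R2 fgl inv Bc; set I := exact_quot 1 (Bc_lead a1 a2 a3).
have IL : I * Bc_lead a1 a2 a3 = 1 by apply: Bc_lead_inv.
(* Vieta's formulas: [I] inverts the leading coefficient, so membership in the family holds by
   construction, and the comparison with [z1] and [z2] remains. *)
exists (- (I * Bc_coef1 (C a1) (C a2) (C a3) u v)), (I * (u - v) ^+ 2); split; last first.
  have x0 (i : 'I_3) : (series_var i : {series R[3]}) 0%MM = 0 by rewrite series_var0.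
  have S := zero_const2 (x0 0) (x0 1).
  have IL' := congr1 (fun f => f \So [tuple series_var 0; series_var 1 : {series R[3]}]) IL.
  rewrite (substM S) (subst1 S) Bc_leadE (subst_coef2 (x0 0) (x0 1)) in IL'.
  rewrite /is_Bc_two_valued -/I (substN _) !(substM S I).
  rewrite (subst_coef1 (x0 0) (x0 1)) (subst_coef0 (x0 0) (x0 1)) /Bc_series Bc_family_coef.
  move: (Bc_coef2 _ _ _ _ _) (Bc_coef1 _ _ _ _ _) IL' => K2 K1 IL'.
  by rewrite !mulrDr [X in _ = X + _ + _]mulrA IL'; ring.
have F0 := fgl0 fgl.
have Nu0 : (- u) 0%MM = 0 by rewrite scoefN u0 oppr0.
have Nv0 : (- v) 0%MM = 0 by rewrite scoefN v0 oppr0.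
have S := zero_const2 u0 Nv0; have [X Y] := subst2_var u0 Nv0.
have xy : u * - u = - (u ^+ 2) /\ v * - v = - (v ^+ 2) by rewrite !mulrN !expr2.
case: xy => xE yE.
have x0 : (- (u ^+ 2)) 0%MM = 0 by rewrite -xE scoefM0 u0 mul0r.
have y0 : (- (v ^+ 2)) 0%MM = 0 by rewrite -yE scoefM0 v0 mul0r.
have S2 := zero_const2 x0 y0.
set Fm := F \So [tuple u; - v].
have z1E : (F \So [tuple u; v]) * (F \So [tuple - u; - v]) = - F ^+ 2.
  by rewrite (fgl_odd fgl inv u0 v0) subst_uv mulrN.
have z2E : Fm * (F \So [tuple - u; v]) = - Fm ^+ 2.
  have := fgl_odd fgl inv u0 Nv0; rewrite opprK => ->.
  by rewrite mulrN.
rewrite /is_modulus_square !bar_var // z1E -/Fm z2E xE yE.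
have IL' := congr1 (fun f => f \So [tuple - (u ^+ 2); - (v ^+ 2)]) IL.
rewrite (substM S2) (subst1 S2) Bc_leadE (subst_coef2 x0 y0) Bc_coef2N in IL'.
rewrite (substN _) !(substM S2 I) (subst_coef1 x0 y0) (subst_coef0 x0 y0) Bc_coef1N.
have A := law_sqr Bc.
(* Replacing [v] by [- v] in [law_sqr] changes only the sign of [w], because the root of [Q] is
   even. *)
have B : qC (C a1) (C a2) (C a3) (u ^+ 2) (v ^+ 2) * Fm ^+ 2 =
    qE (C a1) (C a2) (C a3) (u ^+ 2) (v ^+ 2)
    - 2 * u * v * (p \So [tuple u]) * (p \So [tuple v]).
  have := congr1 (fun f => f \So [tuple u; - v]) A.
  rewrite /qC /qE !(substE S) !(subst1_comp _ _ S) // X Y (root_even R2 Bc v0) sqrrN.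
  by rewrite -/Fm mulrN !mulNr.
have M := qE_conj (root_sqr_u Bc) (root_sqr_v Bc).
move: M A B IL'; rewrite /=.
move: (qC _ _ _ _ _) (qE _ _ _ _ _) (I \So _) (p \So _) (p \So _).
move=> d e J P Q M A B JD; split.
  (* The values are [- (e + w) / d] and [- (e - w) / d], with [J] inverse to [d]: their sum is
     immediate and their product is [M]. *)
  transitivity (- J * (d * F ^+ 2 + d * Fm ^+ 2)); first by rewrite A B; ring.
  transitivity (- (J * d) * (F ^+ 2 + Fm ^+ 2)); first by ring.
  by rewrite JD; ring.
transitivity (J * (J * d) * (u ^+ 2 - v ^+ 2) ^+ 2); first by rewrite JD; ring.
transitivity (J * J * (d * (u ^+ 2 - v ^+ 2) ^+ 2)); first by ring.
rewrite -M -A -B.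
transitivity ((J * d) * (J * d) * (F ^+ 2 * Fm ^+ 2)); first by ring.
by rewrite JD; ring.
Qed.

End Modulus.

(** * Ring morphisms out of the parameter ring *)

Lemma mpoly_eval_rmorphism n (R : comNzRingType) (S : comPzRingType)
    (iota : {rmorphism R -> S}) (a : 'I_n -> S) :
  exists phi : {rmorphism {mpoly R[n]} -> S},
    (forall c, phi c%:MP = iota c) /\ (forall i, phi 'X_i = a i).
Proof.
(* The evaluation [mmap] is taken with a nonzero target. In the zero ring all elements are equal, so
   the constant map is a morphism. *)
have [S0|S1] := eqVneq (1 : S) 0.
  have eqS (x y : S) : x = y by rewrite -[x]mul1r -[y]mul1r S0 !mul0r.
  pose zero (_ : {mpoly R[n]}) : S := 0.
  have zB : zmod_morphism zero by move=> x y; apply: eqS.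
  have zM : monoid_morphism zero by split=> [|x y]; apply: eqS.
  pose Z1 := GRing.isZmodMorphism.Build _ _ zero zB.
  pose Z2 := GRing.isMonoidMorphism.Build _ _ zero zM.
  pose phi : {rmorphism {mpoly R[n]} -> S} := HB.pack zero Z1 Z2.
  by exists phi; split=> *; apply: eqS.
pose nz := GRing.PzSemiRing_isNonZero.Build S S1.
pose S' : comNzRingType := HB.pack S nz.
pose iota' : {rmorphism R -> S'} := iota.
pose phi : {rmorphism {mpoly R[n]} -> S'} := mmap iota' a.
exists phi; split=> [c|i]; first exact: (@mmapC n R S' a iota' c).
rewrite -[LHS]/(mmap iota' a 'X_[U_(i)]) mmapX /mmap1 (bigD1 i) //= big1.
  by rewrite mnm1E eqxx mulr1.
by move=> j ji; rewrite mnm1E eq_sym (negbTE ji).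
Qed.

Lemma mpoly_rmorphism_ext n (R : comNzRingType) (S : comPzRingType)
    (phi psi : {rmorphism {mpoly R[n]} -> S}) :
  (forall c, phi c%:MP = psi c%:MP) -> (forall i, phi 'X_i = psi 'X_i) -> phi =1 psi.
Proof.
move=> eC eX f; rewrite [f]mpolyE !rmorph_sum; apply: eq_bigr => m _.
rewrite -mul_mpolyC !rmorphM eC; congr (_ * _).
rewrite (mpolyXE_id _ m) !rmorph_prod; apply: eq_bigr => i _.
by rewrite !rmorphXn eX.
Qed.

(** Coefficientwise this is a statement about rational numbers. *)
Lemma Zhalf_torsion_free (x : {mpoly Zhalf[3]}) k : x *+ k.+1 = 0 -> x = 0.
Proof.
move=> xk; apply/mpolyP => m; rewrite mcoeff0; apply: val_inj; rewrite /=.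
have : (x *+ k.+1)@_m = 0 by rewrite xk mcoeff0.
rewrite mcoeffMn => /(congr1 val); rewrite raddfMn /= => /eqP.
by rewrite Num.Theory.mulrn_eq0 /= => /eqP.
Qed.

(* A commutative Z[1/2]-algebra is a commutative ring S with its structure
   homomorphism iota, and an algebra homomorphism from R_Bc is a ring
   homomorphism that agrees with iota on the scalars.  *)
Theorem corollary3p3 :
  Bc_kind F_Bc /\
  forall (S : comPzRingType) (iota : {rmorphism Zhalf -> S})
         (F : {series S[2]}),
    Bc_kind F ->
    exists phi : {rmorphism R_Bc -> S},
      [/\ forall c : Zhalf, phi (c%:MP) = iota c,
          F = series_map phi F_Bc
        & forall psi : {rmorphism R_Bc -> S},
            (forall c : Zhalf, psi (c%:MP) = iota c) ->
            F = series_map psi F_Bc -> psi =1 phi].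
Proof.
have [h0 h0E] := Zhalf_2inv.
have R2 : exists h : R_Bc, h + h = 1.
  by exists (h0%:MP); rewrite -mpolyCD h0E.
have [p [H [s Bc]]] := Bc_law_data 'X_0 'X_1 'X_2 R2; rewrite -/F_Bc in Bc.
split.
  have fgl := law_fgl R2 Zhalf_torsion_free Bc.
  have inv : is_formal_inverse F_Bc (- series_var 0).
    split; first by rewrite scoefN series_var0 oppr0.
    exact: (law_inverse Bc).
  split=> //; exists 'X_0, 'X_1, 'X_2.
  exact: (law_modulus_square R2 fgl inv Bc).
move=> S iota F [fgl inv [a1 [a2 [a3 modF]]]].
have S2 : exists h : S, h + h = 1.
  by exists (iota h0); rewrite -rmorphD h0E rmorph1.
have [phi [phiC phiX]] :=
  mpoly_eval_rmorphism iota (tnth [tuple a1; a2; a3]).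
(* The image of [F_Bc] carries [Bc_data] with parameters [a1], [a2], [a3], while [F] satisfies the
   quadratic equation for the same parameters. *)
have Fphi : F = series_map phi F_Bc.
  have := Bc_data_map phi Bc; rewrite !phiX.
  apply: quadratic_unique => //; first exact: (fgl_lead fgl).
  exact: (modulus_square_quadratic fgl inv modF).
exists phi; split=> // psi psiC Fpsi; apply: mpoly_rmorphism_ext.
  by move=> c; rewrite psiC phiC.
(* Both morphisms present the same [F] as a Buchstaber law, so they agree on the three
   generators. *)
have Bphi := Bc_data_map phi Bc; have Bpsi := Bc_data_map psi Bc.
rewrite -Fphi in Bphi; rewrite -Fpsi in Bpsi.
have [e1 e2 e3] := Bc_data_params_unique S2 Bpsi Bphi.
exact: ord3_ind.
Qed.
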